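(* Let $\Theta=f(t)\,dt$ be a Borel probability measure on $[0,\infty)$ that is absolutely continuous with respect to Lebesgue measure, with $0\in\operatorname{supp}\Theta$. Then $\Theta$ is feasible.
   Context: A Borel probability measure $\Theta$ on $[0,\infty)$ is called feasible if there exist a complete separable metric space $(S,d)$, a probability measure $\mu$ on the Borel $\sigma$-field generated by the metric topology of $(S,d)$, and independent random elements $X$ and $Y$ of $S$ with common law $\mu$ such that $d(X,Y)$ has distribution $\Theta$ (equivalently, the pushforward of $\mu\otimes\mu$ under $d$ equals $\Theta$). The condition $0\in\operatorname{supp}\Theta$ means $\Theta([0,\varepsilon])>0$ for every $\varepsilon>0$. *)

(* Defs.v *)
From HB Require Import structures.
From mathcomp Require Import all_boot all_order all_algebra.
From mathcomp Require Import all_classical all_reals all_analysis.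

Set Implicit Arguments.
Unset Strict Implicit.
Unset Printing Implicit Defensive.

Import Order.TTheory GRing.Theory Num.Theory.
Import numFieldNormedType.Exports.

Local Open Scope classical_set_scope.
Local Open Scope ring_scope.

(* [Complete] brings a base point, so these spaces are nonempty; this loses
   nothing for spaces that carry a probability measure. *)
#[short(type="completeMetricType")]
HB.structure Definition CompleteMetric (K : numDomainType) :=
  {T of Metric K T & Complete T}.

Definition separable (T : topologicalType) : Prop :=
  exists2 A : set T, countable A & dense A.

Definition independent_RVs (R : realType)
    (d d1 d2 : measure_display) (Omega : measurableType d)
    (T1 : measurableType d1) (T2 : measurableType d2)
    (P : probability Omega R) (X : {RV P >-> T1}) (Y : {RV P >-> T2}) : Prop :=
  forall (A : set T1) (B : set T2), measurable A -> measurable B ->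
    P (X @^-1` A `&` Y @^-1` B) = (P (X @^-1` A) * P (Y @^-1` B))%E.
Arguments independent_RVs {R d d1 d2 Omega T1 T2} P X Y.

(* A Borel measure on [0, +oo[ is represented by a Borel measure on the line
   that is concentrated on [0, +oo[. *)
Definition on_nonneg_reals (R : realType)
    (Theta : probability (measurableTypeR R) R) : Prop :=
  Theta `[0%R, +oo[%classic = 1%E.

(* The measurability of d(X, Y), automatic when S is separable, is carried by
   the type of D. *)
Definition feasible (R : realType)
    (Theta : probability (measurableTypeR R) R) : Prop :=
  exists (S : completeMetricType R)
         (mu : probability (g_sigma_algebraType (@open S)) R)
         (d : measure_display) (Omega : measurableType d)
         (P : probability Omega R)
         (X Y : {RV P >-> g_sigma_algebraType (@open S)})
         (D : {RV P >-> measurableTypeR R}),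
    [/\ separable S,
        forall A : set (g_sigma_algebraType (@open S)), measurable A ->
          distribution P X A = mu A /\ distribution P Y A = mu A,
        independent_RVs P X Y,
        forall w : Omega, D w = mdist (X w : S) (Y w : S) &
        forall A : set (measurableTypeR R), measurable A ->
          distribution P D A = Theta A].

Definition zero_in_support (R : realType)
    (Theta : probability (measurableTypeR R) R) : Prop :=
  forall eps : R, 0 < eps -> (0 < Theta `[0%R, eps]%classic)%E.

Definition has_density (R : realType)
    (Theta : probability (measurableTypeR R) R) (f : R -> R) : Prop :=
  [/\ measurable_fun (`[0%R, +oo[%classic : set (measurableTypeR R))
        (f : measurableTypeR R -> measurableTypeR R),
      forall t : R, 0 <= t -> 0 <= f t &
      forall A : set (measurableTypeR R), measurable A ->
        A `<=` `[0%R, +oo[%classic ->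
        Theta A = (\int[lebesgue_measure]_(t in A) (f t)%:E)%E].

(* Main.v *)
(* Let Q be the right-continuous quantile function of Theta, and let X and Y be
   independent and uniform on S = [0, 1[. Fix nested partitions of S into
   half-open intervals and write c_l(t) for the left end of the cell of level l
   containing t. Two points s < t which share a cell of level l but no cell of
   level l + 1 are put at distance Q(V_l(t)), where
     V_l(t) = \int_0^1 2 (u - c_{l+1}(u)) du + \int_0^t 2 (c_{l+1} - c_l)(u) du.
   Given t, the points s < t separating from t at level l form the interval
   [c_l(t), c_{l+1}(t)[; hence V is uniformly distributed whatever the
   partitions are, and the distance of X and Y has law Theta.

   The triangle inequality amounts to Q o V_l oscillating by at most
   Q(2^-(m+1)) on the cells of level m > l, where 2^-m is the probability that
   X and Y share a cell of level m. The partitions are built by induction. The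
   leftmost cell [0, T[ of level l carries almost all of the 2^-l. It has to be
   cut at the (near) jumps of Q: cut points g_n for the height correspond to cut
   points t_n of [0, T[ with g_{n+1} - g_n = 2 t_n (t_{n+1} - t_n), and t_0 is
   adjusted for t_n to converge to T. All the other cells are so small that the
   heights of the pairs separating inside them fill a negligible range, on which
   Q hardly varies, so these cells can be refined freely. *)

Require Import Defs.
From HB Require Import structures.
From mathcomp Require Import all_boot all_order all_algebra.
From mathcomp Require Import all_classical all_reals all_analysis.
From mathcomp Require Import measurable_realfun zify ring lra.

Set Implicit Arguments.
Unset Strict Implicit.
Unset Printing Implicit Defensive.

Import Order.TTheory GRing.Theory Num.Theory.
Import numFieldNormedType.Exports.

Local Open Scope classical_set_scope.
Local Open Scope ring_scope.

(** * Integrals and subdivisions *)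

Section primitive.
Context {R : realType}.
Implicit Types (c : R -> R) (s t : R).
Notation mu := (@lebesgue_measure R).

Definition prim c t : R := (\int[mu]_(x in `[0%R, t[) c x)%R.

Lemma nondecreasing_integrable c s t : {homo c : x y / x <= y} ->
  mu.-integrable `[s, t[ (EFin \o c).
Proof.
move=> cm; apply: measurable_bounded_integrable => //.
- rewrite /= lebesgue_measure_itv/=; case: ifPn => // _.
  by rewrite -EFinB ltry.
- exact: nondecreasing_measurable.
- exists (Num.max `|c s| `|c t|); split; first exact: num_real.
  move=> M /= ltM x; rewrite /= in_itv/= => /andP[sx xt].
  have h1 := cm _ _ sx; have h2 := cm _ _ (ltW xt).
  apply: (le_trans _ (ltW ltM)); rewrite ler_norml le_max.
  have := ler_norm (- c s); rewrite normrN => ?.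
  have := ler_norm (c t) => ?.
  have := ler_norm (c s) => ?.
  apply/andP; split; last by apply/orP; right; lra.
  rewrite lerNl le_max; apply/orP; left; lra.
Qed.

Lemma primB c s t : {homo c : x y / x <= y} -> 0 <= s -> s <= t ->
  prim c t - prim c s = (\int[mu]_(x in `[s, t[) c x)%R.
Proof.
move=> cm s0 st; apply/eqP; rewrite subr_eq addrC; apply/eqP.
rewrite /prim -Rintegral_setU//=.
- by rewrite -itv_bndbnd_setU.
- by rewrite -itv_bndbnd_setU//; exact: nondecreasing_integrable.
- by apply: lt_disjoint => x y; rewrite !in_itv/= => /andP[_ ?] /andP[? _]; apply: lt_le_trans; eassumption.
Qed.

Lemma prim0 c : prim c 0 = 0.
Proof. by rewrite /prim set_itv_ge ?Rintegral_set0// bnd_simp ltxx. Qed.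

(** The comparison behind most later estimates; used in both directions it also yields equalities of
    integrals. *)
Lemma ler_primB c c' (k s t : R) : {homo c : x y / x <= y} ->
    {homo c' : x y / x <= y} -> 0 <= s -> s <= t ->
    (forall x, s <= x -> x < t -> c x <= c' x + k) ->
  prim c t - prim c s <= prim c' t - prim c' s + k * (t - s).
Proof.
move=> cm cm' s0 st cc'; rewrite !primB//.
have mI : measurable (`[s, t[ : set (measurableTypeR R)) by [].
have <- : (\int[mu]_(x in `[s, t[) k)%R = k * (t - s).
  rewrite Rintegral_cst//= lebesgue_measure_itv/= lte_fin; case: ltP => [_|ts]//=.
  have -> : t = s by apply: le_anti; rewrite st ts.
  by rewrite subrr.
have ik : mu.-integrable `[s, t[ (EFin \o (fun=> k)).
  exact: (@nondecreasing_integrable (fun=> k)).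
rewrite -RintegralD//; try exact: nondecreasing_integrable.
apply: le_Rintegral => //; first exact: nondecreasing_integrable.
- by apply: (@nondecreasing_integrable (fun x => c' x + k)) => x y xy; rewrite lerD2r cm'.
- by move=> x; rewrite /= in_itv/= => /andP[]; exact: cc'.
Qed.

Lemma primB_cst c (k s t : R) : {homo c : x y / x <= y} ->
    0 <= s -> s <= t -> (forall x, s <= x -> x < t -> c x = k) ->
  prim c t - prim c s = k * (t - s).
Proof.
move=> cm s0 st ck.
have m0 : {homo (fun _ : R => 0 : R) : x y / x <= y} by [].
have p0 u : prim (fun _ : R => 0) u = 0.
  by rewrite /prim Rintegral_cst// mul0r.
have := @ler_primB c (fun=> 0) k s t cm m0 s0 st.
have := @ler_primB (fun=> 0) c (- k) s t m0 cm s0 st.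
rewrite !p0 subrr !add0r mulNr => h1 h2; apply/eqP; rewrite eq_le.
apply/andP; split; first by apply: h2 => x sx xt; rewrite ck.
by rewrite -subr_ge0; apply: h1 => x sx xt; rewrite ck// subrr.
Qed.

Lemma prim_id t : 0 <= t -> prim id t = t ^+ 2 / 2.
Proof.
rewrite le_eqVlt => /predU1P[<-|t0]; first by rewrite prim0 expr0n/= mul0r.
rewrite /prim Rintegral_itv_bndo_bndc; last exact: nondecreasing_integrable.
have D (x : R) : is_derive x 1 (fun x : R => x ^+ 2 / 2) x.
  apply: is_derive_eq; rewrite !scaler0 add0r /GRing.scale/= mulr1; lra.
have cF : continuous (fun x : R => x ^+ 2 / 2).
  by move=> x; apply: differentiable_continuous; apply/derivable1_diffP.
rewrite /Rintegral (@continuous_FTC2 _ _ (fun x => x ^+ 2 / 2) _ _ t0)//=.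
- by rewrite expr0n/= mul0r subr0.
- by apply: continuous_subspaceT => x; exact: cvg_id.
- split=> [x _||]; first exact: (@ex_derive _ _ _ _ _ _ _ (D x)).
  + by apply: cvg_at_right_filter; exact: cF.
  + by apply: cvg_at_left_filter; exact: cF.
- by move=> x _; rewrite derive1E derive_val.
Qed.

End primitive.

(** * Subdivisions on whose pieces a monotone function varies little *)

Section subdivision.
Context {R : realType}.
Implicit Types (f g : R -> R) (a b : R).

Definition mono_on a b f :=
  forall x y, a <= x -> x <= y -> y < b -> f x <= f y.

(** For monotone functions a single [z] to the right of [y] is enough to express right
    continuity. *)
Definition right_cont_on a b f :=
  forall y e, a <= y -> y < b -> 0 < e -> exists2 z, y < z < b & f z <= f y + e.

(** [t n] is the first point where the integer part of [g] has risen by [n]. Right continuity makes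
    this infimum attained, so the integer part is constant on each piece. A jump of [g] may repeat a
    value of [t]. *)
Lemma subdivision_unbounded a b g : a < b -> 0 <= g a ->
    mono_on a b g -> right_cont_on a b g ->
    (forall M, exists2 y, a <= y < b & M <= g y) ->
  exists t : nat -> R, [/\ t 0%N = a, forall n, t n <= t n.+1,
    forall n, t n < b, forall y, y < b -> exists n, y < t n &
    forall n y z, t n <= y -> y <= z -> z < t n.+1 -> g z - g y <= 1].
Proof.
move=> ab ga gm gr gu.
pose N y := Num.truncn (g y).
have g0 y : a <= y -> y < b -> 0 <= g y.
  by move=> ay yb; rewrite (le_trans ga)// gm.
have Nm x y : a <= x -> x <= y -> y < b -> (N x <= N y)%N.
  by move=> ax xy yb; apply: le_truncn; exact: gm.
pose E n := [set y | a <= y < b /\ (N a + n <= N y)%N].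
pose t n := inf (E n).
have E0 n : E n !=set0.
  have [y /andP[ay yb] My] := gu (N a + n).+1%:R.
  exists y; split; first by rewrite ay.
  rewrite /N -(@ler_nat R); have /andP[_] := truncn_itv (g0 _ ay yb).
  move=> h; have := le_lt_trans My h; rewrite ltr_nat ltnS => {}h.
  by rewrite ler_nat; apply: leq_trans h; rewrite leqnSn.
have Elb n : lbound (E n) a by move=> y [/andP[]].
have Ei n : has_inf (E n) by split; [exact: E0|exists a; exact: Elb].
have at_ n : a <= t n by apply: lb_le_inf; [exact: E0|exact: Elb].
have tle n y : a <= y -> y < b -> (N a + n <= N y)%N -> t n <= y.
  by move=> ay yb h; apply: ge_inf; [exists a; exact: Elb|split; rewrite ?ay].
have tb n : t n < b.
  by have [y [/andP[ay yb] h]] := E0 n; exact: le_lt_trans (tle _ _ ay yb h) yb.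
have tge n y : y < b -> t n <= y -> (N a + n <= N y)%N.
  move=> yb ty; rewrite leqNgt; apply/negP => Ny.
  have ay := le_trans (at_ n) ty.
  (* Half the gap to the next integer: the integer part of [g] is then unchanged up to some [z > y],
     which contradicts [t n <= y]. *)
  have [] := gr y (((N y).+1%:R - g y) / 2) ay yb.
    have /andP[_ h] := truncn_itv (g0 _ ay yb).
    by rewrite divr_gt0// subr_gt0.
  move=> z /andP[yz zb] gz.
  have Nz : (N z <= N y)%N.
    rewrite -ltnS -(@ltr_nat R).
    have /andP[h1 _] := truncn_itv (g0 _ (le_trans ay (ltW yz)) zb).
    have /andP[_ h2] := truncn_itv (g0 _ ay yb).
    rewrite -/(N z) -/(N y) in h1 h2; lra.
  have zt0 : 0 < z - t n by lra.
  have [w [/andP[aw wb] Nw] wz] := inf_adherent zt0 (Ei n).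
  have {}wz : w < z.
    by move: wz; rewrite -/(t n) => wz; lra.
  have := Nm _ _ aw (ltW wz) zb; lia.
exists t; split => //.
- apply: le_anti; rewrite at_ andbT; apply: tle => //.
  by rewrite addn0.
- move=> n; apply: lb_le_inf; first exact: E0.
  move=> y [/andP[ay yb] h]; apply: tle => //; lia.
- move=> y yb; have [ay|ya] := leP a y; last first.
    by exists 0%N; exact: lt_le_trans ya (at_ _).
  exists (N y).+1; rewrite ltNge; apply/negP => h.
  by have := tge _ _ yb h; lia.
- move=> n y z ty yz zt.
  have yb : y < b by apply: le_lt_trans (tb n.+1); lra.
  have zb : z < b by apply: lt_trans (tb n.+1).
  have ay := le_trans (at_ n) ty.
  have h1 := tge _ _ yb ty.
  have h2 : (N z <= N a + n)%N.
    rewrite leqNgt; apply/negP => h.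
    have := tle n.+1 z (le_trans ay yz) zb; rewrite addnS => /(_ h); lra.
  have /andP[k1 _] := truncn_itv (g0 _ ay yb).
  have /andP[_ k2] := truncn_itv (g0 _ (le_trans ay yz) zb).
  rewrite -/(N z) -/(N y) in k1 k2.
  have k3 : (N z)%:R <= (N y)%:R :> R by rewrite ler_nat; lia.
  rewrite -natr1 in k2; lra.
Qed.

(** The previous lemma is applied to a sum [g] of nondecreasing terms, so that an increase of [g] by
    at most 1 bounds the increase of each term: one controls [f], another the length of the
    pieces. *)
Lemma subdivision a b f h d : a < b -> 0 < h -> 0 < d ->
    mono_on a b f -> right_cont_on a b f ->
  exists t : nat -> R, [/\ t 0%N = a, forall n, t n <= t n.+1 <= t n + d,
    forall n, t n < b, forall y, y < b -> exists n, y < t n &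
    forall n y z, t n <= y -> y <= z -> z < t n.+1 -> f z - f y <= h].
Proof.
move=> ab h0 d0 fm fr.
(* The last term makes the subdivision accumulate at [b]. *)
pose g y := (f y - f a) / h + (y - a) / d + (b - y)^-1.
have m1 x y : a <= x -> x <= y -> y < b -> 0 <= (f y - f x) / h.
  by move=> ax xy yb; apply: divr_ge0; [rewrite subr_ge0 fm|exact: ltW].
have m2 x y : x <= y -> 0 <= (y - x) / d.
  by move=> xy; apply: divr_ge0; [rewrite subr_ge0|exact: ltW].
have m3 x y : x <= y -> y < b -> (b - x)^-1 <= (b - y)^-1.
  by move=> xy yb; rewrite lef_pV2 ?posrE; lra.
have gE x y : g y - g x = (f y - f x) / h + (y - x) / d + ((b - y)^-1 - (b - x)^-1).
  by rewrite /g !mulrBl; ring.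
have gm : mono_on a b g.
  move=> x y ax xy yb; rewrite -subr_ge0 gE.
  have := m1 _ _ ax xy yb; have := m2 _ _ xy; have := m3 _ _ xy yb; lra.
have [||||t [t0 tm tb tu tg]] := @subdivision_unbounded a b g ab.
- rewrite /g !subrr !mul0r !add0r invr_ge0; lra.
- exact: gm.
- move=> y e ay yb e0.
  have [z /andP[yz zb] fz] := fr y (h * (e / 3)) ay yb ltac:(by rewrite mulr_gt0// divr_gt0).
  (* Each of the three terms of [g] may use a third of [e]; the reciprocal term stays within its
     share up to [b - v^-1]. *)
  pose v := (b - y)^-1 + e / 3.
  have i0 : 0 < (b - y)^-1 by rewrite invr_gt0; lra.
  have v0 : 0 < v by rewrite /v; lra.
  have vb : v^-1 < b - y.
    by rewrite -[ltRHS]invrK ltf_pV2 ?posrE// /v; lra.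
  pose w := Num.min z (Num.min (y + d * (e / 3)) (b - v^-1)).
  have de : 0 < d * (e / 3) by rewrite mulr_gt0// divr_gt0.
  have yw : y < w by rewrite /w !lt_min yz/=; apply/andP; split; lra.
  have wz : w <= z by rewrite /w ge_min lexx.
  have w2 : w <= y + d * (e / 3) by rewrite /w !ge_min lexx ?orbT.
  have w3 : w <= b - v^-1 by rewrite /w !ge_min lexx ?orbT.
  have wb : w < b by exact: le_lt_trans zb.
  exists w; first by rewrite yw wb.
  rewrite -lerBlDl gE.
  have k1 : (f w - f y) / h <= e / 3.
    rewrite ler_pdivrMr// [_ * h]mulrC.
    have := fm _ _ (le_trans ay (ltW yw)) wz zb; lra.
  have k2 : (w - y) / d <= e / 3 by rewrite ler_pdivrMr// [_ * d]mulrC; lra.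
  have k3 : (b - w)^-1 <= v.
    by rewrite -[leRHS]invrK lef_pV2 ?posrE ?invr_gt0//; lra.
  rewrite /v in k3; lra.
- move=> M; pose v := `|M| + (b - a)^-1.
  have i0 : 0 < (b - a)^-1 by rewrite invr_gt0; lra.
  have M0 := normr_ge0 M.
  have v0 : 0 < v by rewrite /v; lra.
  have vb : v^-1 <= b - a.
    by rewrite -[leRHS]invrK lef_pV2 ?posrE// /v; lra.
  have iv0 : 0 < v^-1 by rewrite invr_gt0.
  have ay : a <= b - v^-1 by lra.
  have yb : b - v^-1 < b by lra.
  exists (b - v^-1); first by rewrite ay yb.
  rewrite /g; have -> : b - (b - v^-1) = v^-1 by ring.
  rewrite invrK; have := m1 _ _ (lexx a) ay yb; have := m2 _ _ ay.
  have := ler_norm M; rewrite /v; lra.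
exists t; have ta n : a <= t n.
  by elim: n => [|n IH]; rewrite ?t0// (le_trans IH)//.
have dg n y z : t n <= y -> y <= z -> z < t n.+1 ->
    (f z - f y) / h <= 1 /\ (z - y) / d <= 1.
  move=> ty yz zt; have zb := lt_trans zt (tb n.+1).
  have ay := le_trans (ta n) ty.
  have := tg _ _ _ ty yz zt; rewrite gE.
  have := m1 _ _ ay yz zb; have := m2 _ _ yz; have := m3 _ _ yz zb.
  by move=> *; split; lra.
split => // [n|n y z ty yz zt]; last first.
  by have [+ _] := dg _ _ _ ty yz zt; rewrite ler_pdivrMr// mul1r.
rewrite tm/= leNgt; apply/negP => tt.
(* If a piece were longer than [d], this midpoint would lie in it at distance more than [d] from its
   left end. *)
pose z := (t n + d + t n.+1) / 2.
have [_] := dg n (t n) z (lexx _) ltac:(rewrite /z; lra) ltac:(rewrite /z; lra).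
rewrite ler_pdivrMr// mul1r /z; lra.
Qed.

End subdivision.

(** * Cut points realizing prescribed increments of the height *)

Section weights.
Context {R : realType}.
Variables (m : nat -> R) (M T tau : R).
Hypotheses (tau0 : 0 < tau) (T0 : 0 < T) (m0 : forall n, 0 <= m n)
  (mtau : forall n, m n <= tau ^+ 2) (mM : forall n, \sum_(i < n) m i <= M)
  (MT : tau ^+ 2 + 5 / 4 * M <= T ^+ 2).

(** Solves [m n = 2 * t n * (t n.+1 - t n)] forward from [t 0 = x]: the height gains [m n] across a
    piece whose left end is [t n]. *)
Fixpoint weight (x : R) n : R :=
  if n is n'.+1 then weight x n' + m n' / (2 * weight x n') else x.

Lemma weight_ge x n : tau <= x -> tau <= weight x n.
Proof.
move=> tx; elim: n => //= n IH; rewrite (le_trans IH)// lerDl.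
by rewrite divr_ge0// mulr_ge0// (le_trans (ltW tau0)).
Qed.

(** One step multiplies differences by [1 - m n / (2 * a * b)], which lies between 0 and 1 because
    [m n <= tau ^+ 2 <= a * b]. *)
Lemma weight_lip x y n : tau <= x -> x <= y ->
  0 <= weight y n - weight x n <= y - x.
Proof.
move=> tx xy; elim: n => [|n /=]; first by rewrite lexx andbT subr_ge0.
set a := weight x n; set b := weight y n.
have ta : tau <= a := weight_ge n tx.
have tb : tau <= b := weight_ge n (le_trans tx xy).
move=> /andP[ab1 ab2].
have a0 : 0 < a := lt_le_trans tau0 ta.
have b0 : 0 < b := lt_le_trans tau0 tb.
pose k := m n / (2 * a * b).
have k0 : 0 <= k by rewrite divr_ge0// !mulr_ge0// ltW.
have k1 : k <= 1.
  rewrite ler_pdivrMr ?mulr_gt0// mul1r (le_trans (mtau n))//.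
  have : tau ^+ 2 <= a * b by rewrite expr2 ler_pM// ltW.
  have := mulr_gt0 a0 b0; lra.
have -> : b + m n / (2 * b) - (a + m n / (2 * a)) = (b - a) * (1 - k).
  by rewrite /k; field; rewrite !gt_eqF.
have h1 : 0 <= (b - a) * (1 - k) by rewrite mulr_ge0// subr_ge0.
have h2 : 0 <= (b - a) * k by rewrite mulr_ge0.
apply/andP; split=> //; lra.
Qed.

(** The square of a step is [a ^+ 2 + m n] plus a remainder of at most [m n / 4], since
    [m n <= tau ^+ 2 <= a ^+ 2]; hence the factor 5/4 in [MT]. *)
Lemma weight_tau n : weight tau n <= T.
Proof.
suff h : weight tau n ^+ 2 <= tau ^+ 2 + 5 / 4 * \sum_(i < n) m i.
  rewrite -(@ler_pXn2r _ 2) ?nnegrE ?(ltW T0)//; last first.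
    by rewrite (le_trans (ltW tau0))// weight_ge.
  by have := mM n; have := MT; lra.
elim: n => [|n IH]; first by rewrite big_ord0 mulr0 addr0.
rewrite big_ord_recr /=; set a := weight tau n in IH *.
have ta : tau <= a by exact: weight_ge.
have a0 : 0 < a := lt_le_trans tau0 ta.
have -> : (a + m n / (2 * a)) ^+ 2 = a ^+ 2 + m n + m n * (m n / (4 * a ^+ 2)).
  by field; rewrite gt_eqF.
have h : m n / (4 * a ^+ 2) <= 1 / 4.
  rewrite ler_pdivrMr ?mulr_gt0 ?exprn_gt0//.
  have -> : 1 / 4 * (4 * a ^+ 2) = a ^+ 2 by field.
  by rewrite (le_trans (mtau n))// ler_pXn2r ?nnegrE ?(ltW tau0) ?(ltW a0).
by have := ler_wpM2l (m0 n) h; lra.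
Qed.

(* The limit of [weight x] is 1-Lipschitz and nondecreasing in [x], so it takes
   the value [T] at the largest [x] for which it does not exceed [T]. *)
Lemma exists_weight : exists t : nat -> R, [/\ tau <= t 0%N,
  forall n, t n.+1 = t n + m n / (2 * t n), forall n, t n <= T &
  forall y, y < T -> exists n, y < t n].
Proof.
pose E := [set x | tau <= x /\ forall n, weight x n <= T].
have E0 : E tau by split => // n; exact: weight_tau.
have Es : has_sup E.
  by split; [exists tau|exists T => x [_ /(_ 0%N)]].
pose s := sup E.
have ts : tau <= s by exact: (sup_upper_bound Es).
have sT n : weight s n <= T.
  rewrite leNgt; apply/negP => h.
  have d0 : 0 < weight s n - T by lra.
  have [x Ex xs] := sup_adherent d0 Es.
  have xls : x <= s by exact: (sup_upper_bound Es).
  have /andP[_] := weight_lip n Ex.1 xls.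
  by have := Ex.2 n; rewrite -/s in xs; lra.
exists (weight s); split => // y yT; apply: contrapT => /forallNP h.
have : s + (T - y) <= s.
  apply: (sup_upper_bound Es); split; first lra.
  move=> n; have /negP := h n; rewrite -leNgt => hn.
  have st : s <= s + (T - y) by lra.
  by have /andP[_] := weight_lip n ts st; lra.
lra.
Qed.

End weights.

(** * Nested partitions *)

Section cells.
Context {R : realType}.
Implicit Types (c : R -> R) (s t u v y z : R).

(* [c] sends a point to the left end of its cell, for some partition of the
   line into intervals containing their left end. *)
Definition cell_fun c :=
  (forall t, c t <= t) /\ (forall s t, c t <= s -> s <= t -> c s = c t).

Lemma cell_fun_homo c : cell_fun c -> {homo c : x y / x <= y}.
Proof.
move=> [c1 c2] x y xy; have [yx|xy'] := leP (c y) x; first by rewrite (c2 x y).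
exact: le_trans (c1 x) (ltW xy').
Qed.

Lemma cell_fun_idem c t : cell_fun c -> c (c t) = c t.
Proof. by move=> [c1 c2]; rewrite (c2 (c t) t). Qed.

(** Left ends that only move to the right express that the partition of [c'] refines that of [c]. *)
Lemma cell_fun_refine c c' y z : cell_fun c -> cell_fun c' ->
  (forall x, c x <= c' x) -> c' y = c' z -> c y = c z.
Proof.
move=> cc cc' lec; wlog yz : y z / y <= z => [H e|e].
  by have [|/ltW] := leP y z => ?; [|symmetry]; apply: H.
apply: cc.2 => //; apply: le_trans (lec z) _; rewrite -e; exact: cc'.1.
Qed.

(** No cell of [c] straddles [u] or [v]. The cell with left end [a] is cut at the points [tau a n],
    which exhaust it from inside. So every point has a later piece in its cell and a later point in
    its piece, as the last conclusion records. *)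
Lemma refine_cell_fun c u v (tau : R -> nat -> R) : cell_fun c ->
    (forall y, u <= y -> u <= c y) -> (forall y, v <= y -> v <= c y) ->
    (forall y, u <= y -> y < v -> [/\ tau (c y) 0%N = c y,
       forall n, tau (c y) n <= tau (c y) n.+1, forall n, c (tau (c y) n) = c y &
       exists n, y < tau (c y) n]) ->
  exists c', [/\ cell_fun c', forall y, c y <= c' y,
    forall y, ~~ (u <= y < v) -> c' y = c y,
    forall y, u <= y -> y < v -> exists n,
      [/\ c' y = tau (c y) n, tau (c y) n <= y & y < tau (c y) n.+1] &
    forall y, u <= y -> y < v ->
      (exists z, [/\ y < z, z < v, c z = c y & y < c' z]) /\
      (exists z, [/\ y < z, z < v & c' z = c' y])].
Proof.
move=> cc Hu Hv Ht.
have /choice[c' c'P] : forall y, exists w,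
    (u <= y -> y < v -> exists n,
      [/\ w = tau (c y) n, tau (c y) n <= y & y < tau (c y) n.+1]) /\
    (~~ (u <= y < v) -> w = c y).
  move=> y; have [/andP[uy yv]|] := boolP (u <= y < v); last first.
    by move=> h; exists (c y); split => // uy yv; rewrite uy yv in h.
  have [t0 tm tc [n yn]] := Ht _ uy yv.
  (* The first cut point beyond [y] closes the piece of [y], and its predecessor is the left end;
     index 0 is excluded by [tau (c y) 0 = c y <= y]. *)
  have ex : exists n, y < tau (c y) n by exists n.
  have [k yk kmin] := ex_minnP ex.
  case: k yk kmin => [|k] yk kmin.
    by move: yk; rewrite t0 ltNge cc.1.
  exists (tau (c y) k); split => // _ _; exists k; split => //.
  by rewrite leNgt; apply/negP => /kmin; rewrite ltnn.
have tau_homo y : u <= y -> y < v -> {homo tau (c y) : i j / (i <= j)%N >-> i <= j}.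
  move=> uy yv; have [_ tm _ _] := Ht _ uy yv.
  by apply: homo_leq => // ? ? ?; exact: le_trans.
have cle y : c y <= c' y.
  have [h1 h2] := c'P y.
  have [/andP[uy yv]|/h2 -> //] := boolP (u <= y < v).
  have [n [-> _ _]] := h1 uy yv; have [t0 _ _ _] := Ht _ uy yv.
  by rewrite -{1}t0; exact: tau_homo.
have c'le y : c' y <= y.
  have [h1 h2] := c'P y.
  have [/andP[uy yv]|/h2 ->] := boolP (u <= y < v); last exact: cc.1.
  by have [n [-> ]] := h1 uy yv.
have cc' : cell_fun c'.
  split=> // s t ts st.
  have cst : c s = c t by apply: cc.2 => //; exact: le_trans (cle t) ts.
  have [[s1 s2] [t1 t2]] := (c'P s, c'P t).
  have [/andP[ut tv]|ntv] := boolP (u <= t < v); last first.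
    rewrite (t2 ntv) s2 //; apply: contra ntv => /andP[us sv].
    rewrite (le_trans us st)/= ltNge; apply/negP => /Hv h.
    by have := cc.1 s; rewrite cst; lra.
  have us : u <= s by apply: le_trans (Hu _ ut) (le_trans (cle t) ts).
  have sv : s < v by exact: le_lt_trans tv.
  have [n [tn nt tn1]] := t1 ut tv; have [m [sm ms sm1]] := s1 us sv.
  rewrite sm tn cst; rewrite cst in ms sm1; rewrite tn in ts.
  have th := tau_homo _ ut tv.
  have [mn|nm|->//] := ltngtP m n.
    by have := th _ _ mn; lra.
  by have := th _ _ nm; lra.
exists c'; split => //.
- by move=> y; exact: (c'P y).2.
- by move=> y uy yv; exact: (c'P y).1.
move=> y uy yv; have [_ _ tc _] := Ht _ uy yv.
have [n [yn ny yn1]] := (c'P y).1 uy yv.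
have dom z : y <= z -> c z = c y -> u <= z /\ z < v.
  move=> yz zy; split; first exact: le_trans yz.
  by rewrite ltNge; apply/negP => /Hv; rewrite zy; have := cc.1 y; lra.
have th := tau_homo _ uy yv.
split.
  (* The next cut point is in the same cell of [c] but in a later piece. *)
  exists (tau (c y) n.+1).
  have [uz zv] := dom _ (ltW yn1) (tc _).
  split => //; have [k []] := (c'P _).1 uz zv; rewrite tc => -> _ h.
  apply: (lt_le_trans yn1); apply: (th); rewrite leqNgt; apply/negP => kn.
  by have := th _ _ kn; rewrite leNgt h.
pose z := (y + tau (c y) n.+1) / 2.
have yz : y < z by rewrite /z; lra.
have zn : z < tau (c y) n.+1 by rewrite /z; lra.
have cz : c z = c y.
  have [_ zv] := dom _ (ltW yn1) (tc _).
  rewrite -[RHS](tc n.+1); apply: cc.2; last exact: ltW.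
  by rewrite tc; exact: le_trans (cc.1 y) (ltW yz).
have [uz zv] := dom _ (ltW yz) cz.
exists z; split => //; symmetry; apply: cc'.2; last exact: ltW.
have [k []] := (c'P _).1 uz zv; rewrite cz => -> kz _.
apply: le_trans ny; apply: (th); rewrite leqNgt; apply/negP => nk.
by have := th _ _ nk; lra.
Qed.

End cells.

(** * The invariant of the construction and the cutting of the leftmost cell *)

Section step.
Context {R : realType}.
Implicit Types (c Psi : R -> R) (t y z : R).

Lemma right_cont_on_sub (a b a' b' : R) f : a <= a' -> b' <= b ->
  mono_on a b f -> right_cont_on a b f -> right_cont_on a' b' f.
Proof.
move=> aa bb fm fr y e ay yb e0.
have [z /andP[yz zb] fz] := fr y e (le_trans aa ay) (lt_le_trans yb bb) e0.
pose w := Num.min z ((y + b') / 2).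
have yw : y < w by rewrite lt_min yz/=; lra.
have wz : w <= z by rewrite ge_min lexx.
have wb : w < b' by rewrite gt_min; apply/orP; right; lra.
exists w; first by rewrite yw.
by apply: le_trans fz; apply: fm => //; lra.
Qed.

(** Cells have no last point, so on [[0, 1[] they are half-open intervals of positive length. *)
Definition nondegenerate_cells c :=
  forall y, 0 <= y -> y < 1 -> exists z, [/\ y < z, z < 1 & c z = c y].

(** The cell with left end [a] is [[a, b[] for its supremum [b], which non-degeneracy excludes.
    [Psi] may jump or blow up at [b], which is harmless since the subdivision accumulates there. *)
Lemma cell_subdivision c Psi (h d a : R) : cell_fun c -> nondegenerate_cells c ->
    mono_on 0 1 Psi -> right_cont_on 0 1 Psi -> 0 < h -> 0 < d ->
    0 <= a -> a < 1 -> c a = a ->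
  exists t : nat -> R, [/\ t 0%N = a, forall n, t n <= t n.+1 <= t n + d,
    forall n, c (t n) = a, forall y, y < 1 -> c y = a -> exists n, y < t n &
    forall n y z, t n <= y -> y <= z -> z < t n.+1 -> Psi z - Psi y <= h].
Proof.
move=> cc nd Pm Pr h0 d0 a0 a1 ca.
pose E := [set z | z < 1 /\ c z = a].
have Ea : E a by split.
have Es : has_sup E by split; [exists a|exists 1 => z [/ltW]].
pose b := sup E.
have Elt y : E y -> y < b.
  move=> [y1 cy]; have y0 : 0 <= y by rewrite -cy in a0; exact: le_trans (cc.1 y).
  have [z [yz z1 cz]] := nd _ y0 y1.
  apply: (lt_le_trans yz); apply: (sup_upper_bound Es).
  by split; rewrite ?cz.
have b1 : b <= 1 by apply: ge_sup; [exists a|move=> z [/ltW]].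
have Ein y : a <= y -> y < b -> c y = a.
  move=> ay yb; have yb0 : 0 < b - y by rewrite subr_gt0.
  have [w [w1 cw] yw] := sup_adherent yb0 Es.
  rewrite -cw; apply: cc.2; first by rewrite cw.
  by rewrite -/b in yw; lra.
have [t [t0 tm tb tu tg]] : exists t : nat -> R, [/\ t 0%N = a,
    forall n, t n <= t n.+1 <= t n + d, forall n, t n < b,
    forall y, y < b -> exists n, y < t n &
    forall n y z, t n <= y -> y <= z -> z < t n.+1 -> Psi z - Psi y <= h].
  apply: subdivision => //; first exact: Elt.
  - by move=> x y ax xy yb; apply: Pm => //; lra.
  - exact: (right_cont_on_sub a0 b1 Pm Pr).
exists t; split => //.
- move=> n; apply: Ein => //.
  by elim: n => [|n IH]; rewrite ?t0// (le_trans IH)//; have /andP[] := tm n.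
- by move=> y y1 cy; apply: tu; exact: Elt.
Qed.

(* [T] is the right end of the leftmost cell, [phi] the probability that two
   independent uniform points share a cell, and [Psi] stands for the sum of the
   functions giving the distances at the previous levels. *)
Record level_state (phi delta : R) c (T : R) Psi : Prop := LevelState {
  state_cell : cell_fun c;
  state_T0 : 0 < T;
  state_T1 : T <= 1;
  state_spine : forall y, 0 <= y -> y < T -> c y = 0;
  state_light : forall y, T <= y -> T <= c y;
  state_out : forall y, 1 <= y -> c y = y;
  state_nd : nondegenerate_cells c;
  state_prim : prim c 1 = (1 - phi) / 2;
  state_delta : forall y, T <= y -> y < 1 -> y - c y <= delta;
  state_mono : mono_on 0 1 Psi;
  state_right : right_cont_on 0 1 Psi;
  state_cst : forall y, 0 <= y -> y < T -> Psi y = Psi 0 }.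

Variable Q : R -> R.
Hypotheses (Qm : forall x y : R, 0 < x -> x <= y -> y < 1 -> Q x <= Q y)
  (Qr : forall x e : R, 0 < x -> x < 1 -> 0 < e ->
    exists2 y, x < y < 1 & Q y <= Q x + e).

(** In use [phi] belongs to the finer partition [c']: it is [1 - 2 * prim c' 1], that is, the
    integral of [2 * (u - c' u)] over [[0, 1[]. *)
Definition height (phi : R) c c' y := phi + 2 * (prim c' y - prim c y).

Lemma prim0_spine c (T : R) y : cell_fun c -> 0 <= y -> y <= T ->
  (forall y, 0 <= y -> y < T -> c y = 0) -> prim c y = 0.
Proof.
move=> cc y0 yT c0.
have := @primB_cst R c 0 0 y (cell_fun_homo cc) (lexx _) y0.
by rewrite prim0 subr0 mul0r; apply => x x0 xy; rewrite c0//; lra.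
Qed.

(** [phi] is the integral of [2 * (u - c u)] over [[0, 1[]: the leftmost cell contributes [T ^+ 2],
    and elsewhere [u - c u <= delta]. *)
Lemma state_T_ge phi delta c (T : R) Psi : 0 <= delta ->
  level_state phi delta c T Psi -> phi - 2 * delta <= T ^+ 2.
Proof.
move=> d0 [cc T0 T1 c0 cT cout nd pc cd Pm Pr Pc].
have idm : {homo (@id R) : x y / x <= y} by [].
have := @ler_primB R id c delta T 1 idm (cell_fun_homo cc) (ltW T0) T1.
rewrite !prim_id ?(ltW T0)// pc (prim0_spine cc (ltW T0) (lexx T))// => h.
have /h : forall x, T <= x -> x < 1 -> x <= c x + delta.
  by move=> x Tx x1; have := cd _ Tx x1; lra.
have : 0 <= delta * T by rewrite mulr_ge0// ltW.
by rewrite expr1n; lra.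
Qed.

(** The leftmost cell produces the heights in [[phi / 2, phi - e[]; the range of length [e] above is
    left to the other cells. [g] cuts the heights where [Q] varies, and [t] transports these cuts to
    [[0, T[]. *)
Lemma spine_subdivision (phi e T d h : R) : 0 < phi -> phi <= 1 ->
    0 <= e -> e <= phi / 8 -> 0 < T -> 7 / 8 * phi <= T ^+ 2 -> 0 < d -> 0 < h ->
  exists t g : nat -> R, [/\
    [/\ 0 < t 0%N, forall n, t n < T, forall n, t n <= t n.+1 <= t n + d &
      forall y, y < T -> exists n, y < t n],
    forall n, g n.+1 - g n = 2 * t n * (t n.+1 - t n) &
    [/\ g 0%N = phi / 2, forall n, g n < phi - e,
      forall y, y < phi - e -> exists n, y < g n &
      forall n y z, g n <= y -> y <= z -> z < g n.+1 -> Q z - Q y <= h]].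
Proof.
move=> phi0 phi1 e0 ephi T0 phiT d0 h0.
(* The size condition holds because [phi / 8 + 5 / 4 * (phi / 2)] is below [7 / 8 * phi]. *)
pose tau := Num.sqrt (phi / 8).
have tau0 : 0 < tau by rewrite sqrtr_gt0; lra.
have tau2 : tau ^+ 2 = phi / 8 by rewrite sqr_sqrtr//; lra.
(* The first bound keeps the increments of [g] at most [tau ^+ 2]; the second keeps the steps of
   [t], which are at most [d' / (2 * tau)], at most [d]. *)
pose d' := Num.min (phi / 8) (2 * tau * d).
have d'0 : 0 < d' by rewrite lt_min !mulr_gt0.
have d'1 : d' <= phi / 8 by rewrite ge_min lexx.
have d'2 : d' <= 2 * tau * d by rewrite ge_min lexx orbT.
have ab : phi / 2 < phi - e by lra.
have Qm' : mono_on (phi / 2) (phi - e) Q.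
  by move=> x y ? ? ?; apply: Qm; lra.
have Qr' : right_cont_on (phi / 2) (phi - e) Q.
  move=> y e1 ay yb e10.
  have y0 : 0 < y by lra.
  have y1 : y < 1 by lra.
  have [z /andP[yz z1] Qz] := Qr y0 y1 e10.
  exists (Num.min z ((y + (phi - e)) / 2)).
    by rewrite lt_min gt_min yz/=; apply/andP; split; [|apply/orP; right]; lra.
  apply: le_trans Qz; apply: Qm => //; last by rewrite ge_min lexx.
  by rewrite lt_min; apply/andP; split; lra.
have [g [g0 gm gb gu gh]] := subdivision ab h0 d'0 Qm' Qr'.
pose m n := g n.+1 - g n.
have m0 n : 0 <= m n by rewrite subr_ge0; have /andP[] := gm n.
have md n : m n <= d' by rewrite lerBlDl; have /andP[] := gm n.
have [|||t [t0 tS tT tu]] := @exists_weight R m (phi / 2 - e) T tau tau0 T0 m0.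
- by move=> n; rewrite tau2; exact: le_trans (md n) _.
- move=> n; rewrite -(big_mkord predT m) /m telescope_sumr// g0.
  by have := gb n; lra.
- by rewrite tau2; lra.
have tt n : tau <= t n.
  by elim: n => // n IH; rewrite tS (le_trans IH)// lerDl divr_ge0// mulr_ge0// (le_trans (ltW tau0)).
have tp n : 0 < t n := lt_le_trans tau0 (tt n).
have gt n : g n.+1 - g n = 2 * t n * (t n.+1 - t n).
  by rewrite tS -/(m n); field; rewrite gt_eqF.
have tm n : t n <= t n.+1.
  by rewrite tS lerDl divr_ge0// mulr_ge0// ltW.
have gtT n k : g (n + k)%N - g n <= 2 * T * (t (n + k)%N - t n).
  elim: k => [|k IH]; first by rewrite addn0 !subrr mulr0.
  rewrite addnS; have := gt (n + k)%N; have := tm (n + k)%N.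
  move: IH (tT (n + k)%N); set u := t (n + k)%N; set v := t (n + k).+1.
  move=> IH uT uv guv.
  have : u * (v - u) <= T * (v - u) by rewrite ler_wpM2r// subr_ge0.
  lra.
exists t, g; split => //; split => //.
(* If [t n] reached [T], later cut points could not exceed it and [g] would stop growing, yet some
   [g k] exceeds [g n]. *)
- move=> n; rewrite lt_neqAle tT andbT; apply/negP => /eqP tnT.
  have [k nk] := gu _ (gb n).
  have [kn|nk'] := leqP k n.
    have ghomo : {homo g : i j / (i <= j)%N >-> i <= j}.
      by apply: homo_leq => [//|? ? ?|i]; [exact: le_trans|have /andP[] := gm i].
    by have := ghomo _ _ kn; lra.
  have := gtT n (k - n)%N; rewrite subnKC ?(ltnW nk')// tnT.
  have : 2 * T * (t k - T) <= 0 by rewrite mulr_ge0_le0 ?mulr_ge0 ?(ltW T0)// subr_le0.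
  by lra.
- move=> n; rewrite tm/= tS lerD2l ler_pdivrMr ?mulr_gt0//.
  rewrite (le_trans (md n))// (le_trans d'2)// mulrC [leRHS]mulrC.
  by have := ler_wpM2r (ltW d0) (tt n); lra.
Qed.

End step.

(** * The induction step *)

Section step_lemma.
Context {R : realType}.
Variable Q : R -> R.
Hypotheses (Qm : forall x y : R, 0 < x -> x <= y -> y < 1 -> Q x <= Q y)
  (Qr : forall x e : R, 0 < x -> x < 1 -> 0 < e ->
    exists2 y, x < y < 1 & Q y <= Q x + e).

Lemma ler_prim_diff (c c' : R -> R) (s t : R) : cell_fun c -> cell_fun c' ->
    (forall y, c y <= c' y) -> 0 <= s -> s <= t ->
  prim c' s - prim c s <= prim c' t - prim c t.
Proof.
move=> cc cc' le s0 st.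
have le0 x : s <= x -> x < t -> c x <= c' x + 0 by rewrite addr0.
have := ler_primB (cell_fun_homo cc) (cell_fun_homo cc') s0 st le0.
by rewrite mul0r addr0; lra.
Qed.

Lemma height_homo (phi : R) (c c' : R -> R) (y z : R) : cell_fun c -> cell_fun c' ->
    (forall y, c y <= c' y) -> 0 <= y -> y <= z ->
  height phi c c' y <= height phi c c' z.
Proof.
by move=> cc cc' le y0 yz; have := ler_prim_diff cc cc' le y0 yz; rewrite /height; lra.
Qed.

(** The slope [2 * (c' - c)] is at most 2, as [c' x <= x <= 1] and [c x >= 0]. *)
Lemma height_lip (phi : R) (c c' : R -> R) (y z : R) : cell_fun c -> cell_fun c' ->
    (forall y, 0 <= y -> 0 <= c y) -> 0 <= y -> y <= z -> z <= 1 ->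
  height phi c c' z <= height phi c c' y + 2 * (z - y).
Proof.
move=> cc cc' c_ge0 y0 yz z1.
have le x : y <= x -> x < z -> c' x <= c x + 1.
  by move=> yx xz; have := cc'.1 x; have := c_ge0 x (le_trans y0 yx); lra.
have := ler_primB (cell_fun_homo cc') (cell_fun_homo cc) y0 yz le.
by rewrite /height; lra.
Qed.

Lemma mono_on_comp (V : R -> R) : (forall y, 0 <= y -> y < 1 -> 0 < V y < 1) ->
  mono_on 0 1 V -> mono_on 0 1 (Q \o V).
Proof.
move=> V01 Vm y z y0 yz z1; rewrite /=.
have /andP[h1 _] := V01 y y0 (le_lt_trans yz z1).
have /andP[_ h2] := V01 z (le_trans y0 yz) z1.
by apply: Qm => //; exact: Vm.
Qed.

Lemma right_cont_on_comp (V : R -> R) : (forall y, 0 <= y -> y < 1 -> 0 < V y < 1) ->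
    (forall y z, 0 <= y -> y <= z -> z <= 1 -> V z <= V y + 2 * (z - y)) ->
  right_cont_on 0 1 (Q \o V).
Proof.
move=> V01 Vl y e y0 y1 e0; have /andP[h1 h2] := V01 y y0 y1.
have [w /andP[Vw w1] Qw] := Qr h1 h2 e0.
pose z := Num.min ((y + 1) / 2) (y + (w - V y) / 2).
have z1 : z <= (y + 1) / 2 by rewrite ge_min lexx.
have zw : z <= y + (w - V y) / 2 by rewrite ge_min lexx orbT.
have yz : y < z by rewrite lt_min; apply/andP; split; lra.
have z1' : z < 1 by lra.
exists z; first by rewrite yz.
have /andP[h3 _] := V01 z (le_trans y0 (ltW yz)) z1'.
apply: le_trans Qw; apply: Qm => //.
by have := Vl y z y0 (ltW yz) (ltW z1'); lra.
Qed.

Lemma right_cont_onD (f g : R -> R) : mono_on 0 1 f -> mono_on 0 1 g ->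
  right_cont_on 0 1 f -> right_cont_on 0 1 g ->
  right_cont_on 0 1 (fun y => f y + g y).
Proof.
move=> fm gm fr gr y e y0 y1 e0; have e20 : 0 < e / 2 by lra.
have [u /andP[yu u1] fu] := fr y (e / 2) y0 y1 e20.
have [v /andP[yv v1] gv] := gr y (e / 2) y0 y1 e20.
exists (Num.min u v); first by rewrite lt_min yu yv gt_min u1.
have yw : 0 <= Num.min u v by rewrite le_min; apply/andP; split; lra.
have := fm (Num.min u v) u yw; rewrite ge_min lexx => /(_ isT u1).
have := gm (Num.min u v) v yw; rewrite ge_min lexx orbT => /(_ isT v1).
lra.
Qed.

(** Beyond [y] there is a point [u] in the same cell of [c] but in a later cell of [c']. From [u] to
    a later point [w] of that cell of [c'], the difference [c' - c] is at least [c' u - y > 0], so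
    the height still grows. *)
Lemma height_lt (phi : R) (c c' : R -> R) (y : R) : cell_fun c -> cell_fun c' ->
    (forall y, c y <= c' y) -> 0 <= y -> y < 1 ->
    (exists z, [/\ y < z, z < 1, c z = c y & y < c' z]) ->
    nondegenerate_cells c' ->
  height phi c c' y < height phi c c' 1.
Proof.
move=> cc cc' le y0 y1 [u [yu u1 cu c'u]] nd.
have u0 : 0 <= u by lra.
have [w [uw w1 c'w]] := nd _ u0 u1.
have cw : c w = c u := cell_fun_refine cc cc' le c'w.
have h1 := ler_prim_diff cc cc' le y0 (ltW yu).
have h2 := ler_prim_diff cc cc' le (le_trans u0 (ltW uw)) (ltW w1).
have cx x : u <= x -> x < w -> c x <= c' x + (y - c' u).
  move=> ux xw.
  have -> : c' x = c' u.
    rewrite -c'w; apply: cc'.2; last exact: ltW.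
    by rewrite c'w; exact: le_trans (cc'.1 u) ux.
  have : c x <= y.
    by rewrite (le_trans (cell_fun_homo cc (ltW xw)))// cw cu cc.1.
  by lra.
have h3 := ler_primB (cell_fun_homo cc) (cell_fun_homo cc') u0 (ltW uw) cx.
have : 0 < (c' u - y) * (w - u) by rewrite mulr_gt0// subr_gt0.
by rewrite /height; lra.
Qed.

(** The cells in [[T, 1[] are refined first, since their total height increment fixes the range left
    for the leftmost cell; that cell is then cut at the [t n], and [[0, t 0[] becomes the new
    leftmost cell. If [T = 1] there are no other cells; this covers the first level, where [phi = 1]
    and [Q] may be unbounded below [phi]. *)
Lemma level_step (phi delta delta' h : R) (c : R -> R) (T : R) (Psi : R -> R) :
    0 < phi -> phi <= 1 -> 0 < delta -> delta <= phi / 16 ->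
    0 < delta' -> 0 < h ->
    (T < 1 -> forall x y : R, phi - 2 * delta <= x -> x <= y -> y < phi ->
      Q y - Q x <= h) ->
    level_state phi delta c T Psi ->
  exists c' T', let V := height (phi / 2) c c' in
    [/\ level_state (phi / 2) delta' c' T' (fun y => Psi y + Q (V y)),
      forall y, c y <= c' y,
      forall y, 0 <= y -> y < 1 ->
        exists z, [/\ y < z, z < 1, c z = c y & y < c' z],
      forall y, 0 <= y -> y < 1 -> phi / 2 <= V y < phi &
      forall y z, 0 <= y -> y <= z -> z < 1 -> c' y = c' z ->
        Psi z - Psi y <= h /\ Q (V z) - Q (V y) <= h].
Proof.
move=> phi0 phi1 d0 dphi d'0 h0 Qthin st.
have T2 := state_T_ge (ltW d0) st.
move: st => [cc T0 T1 c0 cT cout nd pc cd Pm Pr Pc].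
have c_ge0 y : 0 <= y -> 0 <= c y.
  move=> y0; have [yT|Ty] := ltP y T; first by rewrite c0.
  by rewrite (le_trans (ltW T0))// cT.
(* [tau a] cuts the cell with left end [a]; at other points [a] a constant sequence serves as a
   dummy. *)
have /choice[tau tauP] : forall a, exists tau : nat -> R, 0 <= a -> a < 1 -> c a = a ->
    [/\ tau 0%N = a, forall n, tau n <= tau n.+1 <= tau n + delta',
      forall n, c (tau n) = a, forall y, y < 1 -> c y = a -> exists n, y < tau n &
    forall n y z, tau n <= y -> y <= z -> z < tau n.+1 -> Psi z - Psi y <= h].
  move=> a; have [[a0 a1 ca]|na] := pselect [/\ 0 <= a, a < 1 & c a = a].
    have [tau tauP] := cell_subdivision cc nd Pm Pr h0 d'0 a0 a1 ca.
    by exists tau.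
  by exists (fun=> 0) => a0 a1 ca; case: na.
have tauE y : 0 <= y -> y < 1 -> [/\ tau (c y) 0%N = c y,
      forall n, tau (c y) n <= tau (c y) n.+1 <= tau (c y) n + delta',
      forall n, c (tau (c y) n) = c y, exists n, y < tau (c y) n &
    forall n u v, tau (c y) n <= u -> u <= v -> v < tau (c y) n.+1 -> Psi v - Psi u <= h].
  move=> y0 y1; have [] := tauP (c y) (c_ge0 _ y0) (le_lt_trans (cc.1 y) y1)
    (cell_fun_idem _ cc).
  by move=> h1 h2 h3 h4 h5; split => //; apply: h4.
have [c1 [cc1 le1 out1 in1 nr1]] : exists c', [/\ cell_fun c', forall y, c y <= c' y,
    forall y, ~~ (T <= y < 1) -> c' y = c y,
    forall y, T <= y -> y < 1 -> exists n,
      [/\ c' y = tau (c y) n, tau (c y) n <= y & y < tau (c y) n.+1] &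
    forall y, T <= y -> y < 1 ->
      (exists z, [/\ y < z, z < 1, c z = c y & y < c' z]) /\
      (exists z, [/\ y < z, z < 1 & c' z = c' y])].
  apply: refine_cell_fun => //; first by move=> y y1; rewrite cout.
  move=> y Ty y1; have [] := tauE y (le_trans (ltW T0) Ty) y1.
  by move=> h1 h2 h3 h4 _; split => // n; have /andP[] := h2 n.
have c1_0 y : 0 <= y -> y < T -> c1 y = 0.
  by move=> y0 yT; rewrite out1 ?c0// negb_and -ltNge yT.
have pcT : prim c T = 0 := prim0_spine cc (ltW T0) (lexx T) c0.
have pc1T : prim c1 T = 0 := prim0_spine cc1 (ltW T0) (lexx T) c1_0.
(* The increment of the height on [T, 1[. *)
pose e := 2 * (prim c1 1 - prim c 1).
have e0 : 0 <= e.
  by have := ler_prim_diff cc cc1 le1 (ltW T0) T1; rewrite pcT pc1T /e; lra.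
(* On [[T, 1[], [c1 x <= x <= c x + delta]; on [[0, T[] both functions vanish. *)
have e1 : e <= 2 * delta.
  have le x : T <= x -> x < 1 -> c1 x <= c x + delta.
    by move=> Tx x1; have := cd _ Tx x1; have := cc1.1 x; lra.
  have := ler_primB (cell_fun_homo cc1) (cell_fun_homo cc) (ltW T0) T1 le.
  rewrite pcT pc1T.
  have : 0 <= delta * T by rewrite mulr_ge0// ltW.
  by rewrite /e; lra.
have ephi : e <= phi / 8 by lra.
have phiT : 7 / 8 * phi <= T ^+ 2 by lra.
have [t [g [[t0 tT tm tu] gt [g0 gb gu gh]]]] :=
  spine_subdivision Qm Qr phi0 phi1 e0 ephi T0 phiT d'0 h0.
(* The left end 0 is put in front of the cuts, so index [n.+1] is the piece starting at [t n]. *)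
pose sigma (a : R) n := if n is n'.+1 then t n' else 0.
have t_homo : {homo t : i j / (i <= j)%N >-> i <= j}.
  by apply: homo_leq => [//|? ? ?|i]; [exact: le_trans|have /andP[] := tm i].
have t_gt0 n : 0 < t n by apply: lt_le_trans t0 _; exact: t_homo.
have [c2 [cc2 le2 out2 in2 nr2]] : exists c', [/\ cell_fun c', forall y, c1 y <= c' y,
    forall y, ~~ (0 <= y < T) -> c' y = c1 y,
    forall y, 0 <= y -> y < T -> exists n,
      [/\ c' y = sigma (c1 y) n, sigma (c1 y) n <= y & y < sigma (c1 y) n.+1] &
    forall y, 0 <= y -> y < T ->
      (exists z, [/\ y < z, z < T, c1 z = c1 y & y < c' z]) /\
      (exists z, [/\ y < z, z < T & c' z = c' y])].
  apply: refine_cell_fun => //.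
  - by move=> y y0; exact: le_trans (c_ge0 _ y0) (le1 y).
  - by move=> y Ty; exact: le_trans (cT _ Ty) (le1 y).
  - move=> y y0 yT; rewrite c1_0//; split => //.
    + by case=> [|n] /=; [exact: ltW|have /andP[] := tm n].
    + by case=> [|n] /=; rewrite c1_0// ltW.
    + by have [n yn] := tu _ yT; exists n.+1.
have le02 y : c y <= c2 y := le_trans (le1 y) (le2 y).
have in2' y : 0 <= y -> y < T -> exists n,
    [/\ c2 y = sigma 0 n, sigma 0 n <= y & y < sigma 0 n.+1].
  by move=> y0 yT; have := in2 _ y0 yT; rewrite c1_0.
have out2' y : T <= y -> c2 y = c1 y.
  by move=> Ty; apply: out2; rewrite negb_and -!ltNge -leNgt Ty orbT.
have c2_0 y : 0 <= y -> y < t 0%N -> c2 y = 0.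
  move=> y0 yt; have [[|n] [-> /= h1 h2]] := in2' _ y0 (lt_trans yt (tT _)); first by [].
  by have := t_homo _ _ (leq0n n); lra.
have c2_slice n y : t n <= y -> y < t n.+1 -> c2 y = t n.
  move=> ty yt; have y0 : 0 <= y := le_trans (ltW (t_gt0 n)) ty.
  have [[|k] [-> /= h1 h2]] := in2' _ y0 (lt_trans yt (tT _)).
    by have := t_homo _ _ (leq0n n); lra.
  have [kn|nk|->//] := ltngtP k n.
    by have := t_homo _ _ kn; lra.
  by have := t_homo _ _ nk; lra.
have pc2_slice n y z : t n <= y -> y <= z -> z <= t n.+1 ->
    prim c2 z - prim c2 y = t n * (z - y).
  move=> ty yz zt; apply: primB_cst => //; first exact: cell_fun_homo.
    exact: le_trans (ltW (t_gt0 n)) ty.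
  by move=> x yx xz; apply: c2_slice; lra.
have pc2_0 y : 0 <= y -> y <= t 0%N -> prim c2 y = 0.
  by move=> y0 yt; apply: (prim0_spine cc2 y0 yt c2_0).
have pc_0 y : 0 <= y -> y <= T -> prim c y = 0.
  by move=> y0 yT; apply: (prim0_spine cc y0 yT c0).
(* [c2] is constantly [t n] on the piece up to [t n.+1], so the relation between [t] and [g] makes
   the height at each cut point exactly [g n]. *)
have pc2_t n : phi / 2 + 2 * prim c2 (t n) = g n.
  elim: n => [|n IH]; first by rewrite pc2_0// ?g0 ?mulr0 ?addr0// ltW.
  have /andP[tn _] := tm n.
  by have := pc2_slice n _ _ (lexx _) tn (lexx _); have := gt n; lra.
have V_mono y z : 0 <= y -> y <= z ->
    height (phi / 2) c c2 y <= height (phi / 2) c c2 z.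
  exact: height_homo.
have V_t n : height (phi / 2) c c2 (t n) = g n.
  by rewrite /height pc_0 ?ltW// subr0.
have V_lip y z : 0 <= y -> y <= z -> z <= 1 ->
    height (phi / 2) c c2 z <= height (phi / 2) c c2 y + 2 * (z - y).
  exact: height_lip.
(* [g n] tends to [phi - e] while [t n] tends to [T]: the Lipschitz bound gives one inequality and
   monotonicity the other. *)
have V_T : height (phi / 2) c c2 T = phi - e.
  apply: le_anti; apply/andP; split.
    apply/ler_addgt0Pr => eps eps0.
    have [n tn] := tu (T - eps / 2) ltac:(lra).
    have := V_lip _ _ (ltW (t_gt0 n)) (ltW (tT n)) T1.
    by rewrite V_t; have := gb n; lra.
  rewrite leNgt; apply/negP => /gu[n]; rewrite -V_t => h1.
  by have := V_mono _ _ (ltW (t_gt0 n)) (ltW (tT n)); lra.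
(* On [[T, 1[] the height gains [e] and so ends at [phi]; this forces the integral that [state_prim]
   demands for [phi / 2]. *)
have pc2_1 : prim c2 1 = (1 - phi / 2) / 2.
  have eq x : T <= x -> x < 1 -> c2 x <= c1 x + 0 by move=> Tx _; rewrite out2' ?addr0.
  have eq' x : T <= x -> x < 1 -> c1 x <= c2 x + 0 by move=> Tx _; rewrite out2' ?addr0.
  have h1 := ler_primB (cell_fun_homo cc1) (cell_fun_homo cc2) (ltW T0) T1 eq'.
  have h2 := ler_primB (cell_fun_homo cc2) (cell_fun_homo cc1) (ltW T0) T1 eq.
  by move: V_T; rewrite /height pcT; move: h1 h2; rewrite pc1T /e; lra.
have V_1 : height (phi / 2) c c2 1 = phi by rewrite /height pc2_1 pc; lra.
have V_0 y : 0 <= y -> y <= t 0%N -> height (phi / 2) c c2 y = phi / 2.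
  move=> y0 yt; rewrite /height pc2_0// pc_0 ?subrr ?mulr0 ?addr0//.
  exact: le_trans yt (ltW (tT _)).
have nr y : 0 <= y -> y < 1 -> exists z, [/\ y < z, z < 1, c z = c y & y < c2 z].
  move=> y0 y1; have [yT|Ty] := ltP y T.
    have [[z [yz zT cz c2z]] _] := nr2 _ y0 yT.
    exists z; split => //; first exact: lt_le_trans T1.
    exact: cell_fun_refine le1 cz.
  have [[z [yz z1 cz c1z]] _] := nr1 _ Ty y1.
  by exists z; split => //; rewrite out2' ?(le_trans Ty (ltW yz)).
have nd2 : nondegenerate_cells c2.
  move=> y y0 y1; have [yT|Ty] := ltP y T.
    have [_ [z [yz zT cz]]] := nr2 _ y0 yT.
    by exists z; split => //; exact: lt_le_trans T1.
  have [_ [z [yz z1 cz]]] := nr1 _ Ty y1.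
  by exists z; split => //; rewrite !out2' ?(le_trans Ty (ltW yz)).
have V_itv y : 0 <= y -> y < 1 -> phi / 2 <= height (phi / 2) c c2 y < phi.
  move=> y0 y1; rewrite -{1}(V_0 0 (lexx _) (ltW (t_gt0 0%N))) V_mono//=.
  by rewrite -[ltRHS]V_1; apply: height_lt => //; exact: nr.
have V_01 y : 0 <= y -> y < 1 -> 0 < height (phi / 2) c c2 y < 1.
  move=> y0 y1; have /andP[h1 h2] := V_itv y y0 y1.
  by rewrite (lt_le_trans _ h1) ?divr_gt0//= (lt_le_trans h2 phi1).
have V_on : mono_on 0 1 (height (phi / 2) c c2) by move=> y z y0 yz _; exact: V_mono.
have QV_mono := mono_on_comp V_01 V_on.
exists c2, (t 0%N); split => //.
- split => //.
  + exact: le_trans (ltW (tT _)) T1.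
  + move=> y ty; have [yT|Ty] := ltP y T; last first.
      by rewrite out2'//; apply: le_trans (ltW (tT _)) (le_trans (cT _ Ty) (le1 _)).
    have [[|n] [-> /= h1 h2]] := in2' _ (le_trans (ltW (t_gt0 _)) ty) yT; first lra.
    exact: t_homo.
  + by move=> y y1; rewrite out2' ?(le_trans T1)// out1 ?cout// negb_and -!ltNge -leNgt y1 orbT.
  + move=> y ty y1; have [yT|Ty] := ltP y T.
      have [[|n] [-> /= h1 h2]] := in2' _ (le_trans (ltW (t_gt0 _)) ty) yT; first lra.
      by have /andP[_] := tm n; lra.
    have [n [c1E h1 h2]] := in1 _ Ty y1.
    have [_ tau2 _ _ _] := tauE y (le_trans (ltW T0) Ty) y1.
    by rewrite out2'// c1E; have /andP[_] := tau2 n; lra.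
  + by move=> x y x0 xy y1; rewrite lerD ?Pm//; exact: QV_mono.
  + by apply: right_cont_onD => //; exact: right_cont_on_comp.
  + move=> y y0 yt; rewrite !V_0 ?(ltW (t_gt0 _)) ?(ltW yt)//.
    by rewrite (Pc y y0 (lt_trans yt (tT _))).
- move=> y z y0 yz z1 c2yz.
  (* A new cell lies in [[T, 1[] or in [[0, T[]. In the first case [tau] controls [Psi], and the
     heights are at least [phi - e >= phi - 2 * delta]; in the second [Psi] is constant and [g]
     controls the heights. *)
  have [Tz|zT] := leP T z.
    have Ty : T <= y.
      rewrite (le_trans _ (cc2.1 y))// c2yz out2'//.
      exact: le_trans (cT _ Tz) (le1 _).
    have y1 := le_lt_trans yz z1.
    split; last first.
      apply: Qthin; first exact: le_lt_trans z1.
      + have := V_mono T y (ltW T0) Ty; rewrite V_T; lra.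
      + exact: V_mono.
      + by have /andP[] := V_itv z (le_trans y0 yz) z1.
    have cyz : c y = c z := cell_fun_refine cc cc2 le02 c2yz.
    have [n [c1y h1 h2]] := in1 _ Ty y1.
    have [k [c1z h3 h4]] := in1 _ Tz z1.
    have [_ tau2 _ _ osc] := tauE y y0 y1.
    move: c2yz; rewrite !out2'// c1y c1z -cyz => nk.
    rewrite -cyz in h3 h4.
    have tauh : {homo tau (c y) : i j / (i <= j)%N >-> i <= j}.
      by apply: homo_leq => [//|? ? ?|i]; [exact: le_trans|have /andP[] := tau2 i].
    have kn : k = n.
      have [kn|kn|//] := ltngtP k n.
        by have := lt_le_trans h4 (tauh _ _ kn); rewrite ltNge (le_trans h1 yz).
      by have := lt_le_trans h2 (tauh _ _ kn); rewrite -nk ltNge h1.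
    by apply: (osc n) => //; rewrite -kn.
  have yT := le_lt_trans yz zT.
  have z0 := le_trans y0 yz.
  split; first by rewrite (Pc _ y0 yT) (Pc _ z0 zT) subrr ltW.
  have [n [c2y h1 h2]] := in2' _ y0 yT.
  have [k [c2z h3 h4]] := in2' _ z0 zT.
  have sh : {homo sigma 0 : i j / (i <= j)%N >-> i <= j}.
    by case=> [|i] [|j] //= ij; [exact: ltW|exact: t_homo].
  rewrite c2y c2z in c2yz.
  have kn : k = n.
    have [kn|kn|//] := ltngtP k n.
      by have := lt_le_trans h4 (sh _ _ kn); rewrite ltNge (le_trans h1 yz).
    by have := lt_le_trans h2 (sh _ _ kn); rewrite -c2yz ltNge h1.
  (* Index 0 is the piece [[0, t 0[], on which the height is constantly [phi / 2]. *)
  subst k; case: n {c2y c2z c2yz h3} h1 h2 h4 => [|n] /= h1 h2 h4.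
    by rewrite !V_0 ?subrr ?(ltW h0) ?(ltW h2) ?(ltW h4).
  apply: (gh n); last 2 first.
  - exact: V_mono.
  (* Strictly below [g n.+1], because the height has slope [2 * t n > 0] on this piece. *)
  - rewrite -(V_t n.+1) /height !pc_0 ?(ltW (tT _)) ?(ltW zT) ?(ltW (t_gt0 _))//.
    have := pc2_slice n z (t n.+1) (le_trans h1 yz) (ltW h4) (lexx _).
    have : 0 < t n * (t n.+1 - z) by rewrite mulr_gt0// subr_gt0.
    by lra.
  - by rewrite -(V_t n); apply: V_mono => //; exact: ltW.
Qed.

End step_lemma.

(** * The sequence of partitions *)

Section levels.
Context {R : realType}.
Variable Q : R -> R.
Hypotheses (Qm : forall x y : R, 0 < x -> x <= y -> y < 1 -> Q x <= Q y)
  (Qr : forall x e : R, 0 < x -> x < 1 -> 0 < e ->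
    exists2 y, x < y < 1 & Q y <= Q x + e)
  (Q0 : forall x : R, 0 < x -> x < 1 -> 0 < Q x).

Definition phi l : R := 2^-1 ^+ l.

Lemma phi_gt0 l : 0 < phi l. Proof. by rewrite exprn_gt0. Qed.

Lemma phiS l : phi l.+1 = phi l / 2. Proof. by rewrite /phi exprSr. Qed.

Lemma phi_homo : {homo phi : i j / (i <= j)%N >-> j <= i}.
Proof.
apply: homo_leq => [//|x y z xy yz|i]; first exact: le_trans yz xy.
by rewrite phiS; have := phi_gt0 i; lra.
Qed.

Lemma phi_le1 l : phi l <= 1.
Proof. by have := phi_homo (leq0n l); rewrite /phi expr0. Qed.

Lemma phiS_lt1 l : phi l.+1 < 1.
Proof. by rewrite phiS; have := phi_le1 l; lra. Qed.

(** As [p < 1], [Q] is bounded by [Q p] on []0, p[] and has a left limit at [p]; [x] is a point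
    where [Q] is within [h] of it. *)
Lemma Q_thin (p h : R) : 0 < p -> p < 1 -> 0 < h -> exists delta,
  [/\ 0 < delta, delta <= p / 16 &
    forall x y, p - 2 * delta <= x -> x <= y -> y < p -> Q y - Q x <= h].
Proof.
move=> p0 p1 h0.
pose E := [set Q x | x in [set x | 0 < x < p]].
have Es : has_sup E.
  split; first by exists (Q (p / 2)), (p / 2) => //=; apply/andP; split; lra.
  by exists (Q p) => _ [x /= /andP[x0 xp] <-]; apply: Qm => //; exact: ltW.
have [_ [x /= /andP[x0 xp] <-] sx] := sup_adherent h0 Es.
exists (Num.min (p / 16) ((p - x) / 2)); split.
- by rewrite lt_min; apply/andP; split; lra.
- by rewrite ge_min lexx.
have : Num.min (p / 16) ((p - x) / 2) <= (p - x) / 2 by rewrite ge_min lexx orbT.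
move: (Num.min _ _) => d dx y z dy yz zp.
have : Q z <= sup E by apply: (sup_upper_bound Es); exists z => //=; apply/andP; split; lra.
have : Q x <= Q y by apply: Qm; lra.
by lra.
Qed.

(** The last component of a state is the sum of the [Q \o V j] over the previous levels. Its
    summands are nondecreasing, so a small variation of the sum on a cell bounds that of each
    summand. *)
Lemma exists_levels : exists c : nat -> R -> R,
  let V l := height (phi l.+1) (c l) (c l.+1) in
  [/\ [/\ forall l, cell_fun (c l), forall y, 0 <= y -> y < 1 -> c 0%N y = 0,
        forall l y, c l y <= c l.+1 y & forall l, nondegenerate_cells (c l)],
      forall l y, 0 <= y -> y < 1 ->
        exists z, [/\ y < z, z < 1, c l z = c l y & y < c l.+1 z],
      forall l, prim (c l) 1 = (1 - phi l) / 2,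
      forall l y, 0 <= y -> y < 1 -> phi l.+1 <= V l y < phi l &
      forall l m y z, (l < m)%N -> 0 <= y -> y <= z -> z < 1 ->
        c m y = c m z -> Q (V l z) - Q (V l y) <= Q (phi m.+1)].
Proof.
have Qphi l : 0 < Q (phi l.+1) by apply: Q0; [exact: phi_gt0|exact: phiS_lt1].
(* At level 0, where [phi 0 = 1], only the size of [delta] is asked for; [inv] makes up for it by
   recording [T = 1]. *)
have /choice[delta deltaP] : forall l, exists delta, [/\ 0 < delta,
    delta <= phi l / 16 & (0 < l)%N ->
    forall x y, phi l - 2 * delta <= x -> x <= y -> y < phi l ->
      Q y - Q x <= Q (phi l.+2)].
  case=> [|l]; last first.
    have [d [d0 d1 dx]] := Q_thin (phi_gt0 l.+1) (phiS_lt1 l) (Qphi l.+2).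
    by exists d.
  by exists (phi 0 / 16); split => //; rewrite divr_gt0// phi_gt0.
pose st := ((R -> R) * R * (R -> R))%type.
pose inv l (s : st) := level_state (phi l) (delta l) s.1.1 s.1.2 s.2 /\
  ((0 < l)%N \/ s.1.2 = 1).
pose V l (s s' : st) := height (phi l.+1) s.1.1 s'.1.1.
pose rel l (s s' : st) := [/\
  forall y, s'.2 y = s.2 y + Q (V l s s' y),
  forall y, s.1.1 y <= s'.1.1 y,
  forall y, 0 <= y -> y < 1 ->
    exists z, [/\ y < z, z < 1, s.1.1 z = s.1.1 y & y < s'.1.1 z],
  forall y, 0 <= y -> y < 1 -> phi l.+1 <= V l s s' y < phi l &
  forall y z, 0 <= y -> y <= z -> z < 1 -> s'.1.1 y = s'.1.1 z ->
    s.2 z - s.2 y <= Q (phi l.+2) /\ Q (V l s s' z) - Q (V l s s' y) <= Q (phi l.+2)].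
(* [F] performs one step on states satisfying the invariant and leaves the others unchanged. *)
have /choice[F FP] : forall ls : nat * st, exists s', inv ls.1 ls.2 ->
    inv ls.1.+1 s' /\ rel ls.1 ls.2 s'.
  move=> [l s] /=; have [[sl lT]|ns] := pselect (inv l s); last by exists s.
  have [d0 d1 dthin] := deltaP l; have [d0' _ _] := deltaP l.+1.
  have [|c' [T' [st' le nr Vl osc]]] := level_step Qm Qr (phi_gt0 l) (phi_le1 l)
    d0 d1 d0' (Qphi l.+1) _ sl.
    by case: lT => [l0 _|->]; [exact: dthin|rewrite ltxx].
  rewrite -phiS in st' Vl osc.
  exists (c', T', fun y => s.2 y + Q (height (phi l.+1) s.1.1 c' y)) => _.
  by split; [split => //; left|split].
(* One cell [[0, 1[], and single points outside it. *)
pose c00 (y : R) : R := if 0 <= y < 1 then 0 else y.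
pose s0 : st := (c00, 1, fun=> 0).
pose s := fix s l := if l is l'.+1 then F (l', s l') else s0.
have s0P : inv 0%N s0.
  split; last by right.
  have c0E (y : R) : 0 <= y -> y < 1 -> c00 y = 0 by move=> y0 y1; rewrite /c00 y0 y1.
  have cc0 : cell_fun c00.
    split=> [t|u t]; rewrite /c00; first by case: ifP => // /andP[].
    case: ifPn => [/andP[t0 t1] u0 ut|/negbTE nt tu ut].
      by rewrite u0 (le_lt_trans ut).
    have -> : u = t by apply: le_anti; rewrite tu ut.
    by rewrite nt.
  split=> //=.
  - by move=> y y1; have := cc0.1; rewrite /c00 ltNge y1 andbF.
  - by move=> y y1; rewrite /c00 ltNge y1 andbF.
  - move=> y y0 y1; exists ((y + 1) / 2); split; try lra.
    by rewrite !c0E//; lra.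
  - rewrite (prim0_spine cc0 ler01 (lexx 1) c0E) /phi expr0; lra.
  - by move=> y y1 /(le_lt_trans y1); rewrite ltxx.
  - by move=> y e y0 y1 e0; exists ((y + 1) / 2); [apply/andP; split|]; lra.
have sP l : inv l (s l) /\ rel l (s l) (s l.+1).
  suff h : inv l (s l) by split => //; have [] := FP (l, s l) h.
  by elim: l => [//|l IH] /=; have [] := FP (l, s l) IH.
have cc l : cell_fun (s l).1.1 by have [[[]]] := sP l.
pose W l := V l (s l) (s l.+1).
have Wi l y : 0 <= y -> y < 1 -> phi l.+1 <= W l y < phi l.
  by move=> y0 y1; have [_ [_ _ _ h _]] := sP l; exact: h.
have QW l y z : 0 <= y -> y <= z -> z < 1 -> Q (W l y) <= Q (W l z).
  move=> y0 yz z1.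
  have /andP[h1 _] := Wi l y y0 (le_lt_trans yz z1).
  have /andP[_ h2] := Wi l z (le_trans y0 yz) z1.
  apply: Qm; [exact: lt_le_trans (phi_gt0 _) h1| |exact: lt_le_trans h2 (phi_le1 l)].
  have [_ [_ le _ _ _]] := sP l.
  by have := ler_prim_diff (cc l) (cc l.+1) le y0 yz; rewrite /W /V /height; lra.
have Psi_ge l j y z : (j < l)%N -> 0 <= y -> y <= z -> z < 1 ->
    Q (W j z) - Q (W j y) <= (s l).2 z - (s l).2 y.
  move=> jl y0 yz z1; elim: l jl => // l IH; rewrite ltnS leq_eqVlt.
  have [_ [PsiE _ _ _ _]] := sP l; rewrite !PsiE -/(W l).
  have Pm : (s l).2 y <= (s l).2 z.
    by have [[[_ _ _ _ _ _ _ _ _ Pm _ _] _] _] := sP l; exact: Pm.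
  move=> /orP[/eqP ->|/IH]; first lra.
  by have := QW l _ _ y0 yz z1; lra.
exists (fun l => (s l).1.1) => /=; split => //.
- split => //; first by move=> y y0 y1; rewrite /= /c00 y0 y1.
    by move=> l y; have [_ [_ h _ _ _]] := sP l; exact: h.
  by move=> l; have [[[]]] := sP l.
- by move=> l y y0 y1; have [_ [_ _ h _ _]] := sP l; exact: h.
- by move=> l; have [[[]]] := sP l.
- move=> l [//|m] y z; rewrite ltnS leq_eqVlt => lm y0 yz z1 cyz.
  have [_ [_ _ _ _ h]] := sP m.
  have [h1 h2] := h y z y0 yz z1 cyz.
  case/orP: lm => [/eqP ->//|lm].
  by apply: le_trans h1; exact: Psi_ge.
Qed.

End levels.

(** * The metric *)

Record complete_dist (R : realType) (T : choiceType) := CompleteDist {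
  cd_dist : T -> T -> R;
  cd_distxx : forall x, cd_dist x x = 0;
  cd_positivity : forall x y, cd_dist x y = 0 -> x = y;
  cd_sym : forall x y, cd_dist x y = cd_dist y x;
  cd_triangle : forall y x z, cd_dist x z <= cd_dist x y + cd_dist y z;
  cd_point : T;
  cd_complete : forall F : set_system T, ProperFilter F ->
    (forall e, 0 < e -> exists x, F [set y | cd_dist x y < e]) ->
    exists x, forall e, 0 < e -> F [set y | cd_dist x y < e] }.

(* The distance is an argument of the type, so that the instances below can be
   inferred for every distance. *)
Definition dist_space (R : realType) (T : choiceType) (m : complete_dist R T) : Type := T.

Section dist_space.
Context (R : realType) (T : choiceType) (m : complete_dist R T).
Local Notation S := (dist_space m).

HB.instance Definition _ := Choice.on S.
HB.instance Definition _ := isPointed.Build S (cd_point m).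
HB.instance Definition _ := @isMetric.Build R S (@cd_dist R T m)
  (@cd_distxx R T m) (@cd_positivity R T m) (@cd_sym R T m) (@cd_triangle R T m).

Lemma dist_space_complete (F : set_system S) :
  ProperFilter F -> cauchy F -> cvg F.
Proof.
move=> FF /(@cauchyP R) cF.
have [x xF] := @cd_complete R T m F FF (fun e e0 => cF e e0).
apply/cvg_ex; exists x; apply/(@cvg_ballP R S) => e e0.
exact: xF.
Qed.

HB.instance Definition _ := Uniform_isComplete.Build S dist_space_complete.

End dist_space.

(** * A complete metric from nested partitions *)

Section cell_distance.
Context {R : realType}.
Variables (c psi : nat -> R -> R) (lo : nat -> R).
Hypotheses (cc : forall l, cell_fun (c l))
  (c0 : forall y, 0 <= y -> y < 1 -> c 0%N y = 0)
  (cle : forall l y, c l y <= c l.+1 y)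
  (cnr : forall l y, 0 <= y -> y < 1 ->
    exists z, [/\ y < z, z < 1, c l z = c l y & y < c l.+1 z])
  (csep : forall y z, 0 <= y -> y < z -> z < 1 -> exists l, c l y != c l z)
  (lo_gt0 : forall l, 0 < lo l)
  (lo_cvg : forall e, 0 < e -> exists l, lo l < e)
  (psi_mono : forall l y z, 0 <= y -> y <= z -> z < 1 -> psi l y <= psi l z)
  (psi_ge : forall l y, 0 <= y -> y < 1 -> lo l <= psi l y)
  (psi_le : forall l y, 0 <= y -> y < 1 -> psi l.+1 y <= lo l)
  (psi_osc : forall l m y z, (l < m)%N -> 0 <= y -> y <= z -> z < 1 ->
    c m y = c m z -> psi l z - psi l y <= lo m).

Let cle_trans l m y : (l <= m)%N -> c l y <= c m y.
Proof.
elim: m => [|m IH]; first by rewrite leqn0 => /eqP ->.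
rewrite leq_eqVlt => /predU1P[->//|]; rewrite ltnS => /IH h.
exact: le_trans (cle _ _).
Qed.

Let agree_le l m y z : (l <= m)%N -> c m y = c m z -> c l y = c l z.
Proof. by move=> lm; apply: cell_fun_refine => // x; exact: cle_trans. Qed.

Let lo_homo l m : (l <= m)%N -> lo m <= lo l.
Proof.
elim: m => [|m IH]; first by rewrite leqn0 => /eqP ->.
rewrite leq_eqVlt => /predU1P[->//|]; rewrite ltnS => /IH; apply: le_trans.
exact: le_trans (psi_ge _ (lexx 0) ltr01) (psi_le _ (lexx 0) ltr01).
Qed.

Let psi_le_lo l m y : (l < m)%N -> 0 <= y -> y < 1 -> psi m y <= lo l.
Proof.
case: m => // m; rewrite ltnS => lm y0 y1.
exact: le_trans (psi_le _ y0 y1) (lo_homo lm).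
Qed.

(* The level at which [y] and [z] separate; meaningless if [y = z]. *)
Definition sep_level (y z : R) : nat :=
  if pselect (exists n, c n.+1 y != c n.+1 z) is left ex then ex_minn ex else 0%N.

Definition cell_dist (y z : R) : R :=
  if y == z then 0 else psi (sep_level y z) (Num.max y z).

(** By refinement, sharing a cell passes to coarser levels; level 0 has a single cell, so the search
    may start at level 1. *)
Lemma sep_levelP y z l : 0 <= y -> y < 1 -> 0 <= z -> z < 1 -> y != z ->
  (l <= sep_level y z)%N = (c l y == c l z).
Proof.
move=> y0 y1 z0 z1 yz; rewrite /sep_level; case: pselect => [ex|nex]; last first.
  exfalso; apply: nex.
  have [n] : exists n, c n y != c n z.
    move: yz; rewrite neq_lt => /orP[] h; first exact: csep.
    by have [n] := csep z0 h y1; rewrite eq_sym => ?; exists n.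
  case: n => [|n]; first by rewrite !c0// eqxx.
  by exists n.
case: ex_minnP => n cn nmin; apply/idP/eqP => [|cl].
  case: l => [_|l ln]; first by rewrite !c0.
  by apply/eqP; apply: contraTT ln => /nmin; rewrite -ltnNge ltnS.
rewrite leqNgt; apply/negP => nl.
by have := agree_le nl cl => /eqP; rewrite (negbTE cn).
Qed.

Lemma cell_distE y z : y < z -> cell_dist y z = psi (sep_level y z) z.
Proof. by move=> yz; rewrite /cell_dist lt_eqF// max_r// ltW. Qed.

Lemma cell_distxx y : cell_dist y y = 0.
Proof. by rewrite /cell_dist eqxx. Qed.

Lemma cell_dist_sym y z : cell_dist y z = cell_dist z y.
Proof.
rewrite /cell_dist eq_sym maxC; case: eqP => // _; congr psi.
rewrite /sep_level; case: pselect => [ex|nex]; case: pselect => [ex'|nex'] //.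
- by apply: eq_ex_minn => n; rewrite eq_sym.
- by exfalso; apply: nex'; case: ex => n; exists n; rewrite eq_sym.
- by exfalso; apply: nex; case: ex' => n; exists n; rewrite eq_sym.
Qed.

Lemma cell_dist_pos y z : 0 <= y -> y < 1 -> 0 <= z -> z < 1 ->
  cell_dist y z = 0 -> y = z.
Proof.
move=> y0 y1 z0 z1; rewrite /cell_dist; case: eqP => // _ h.
have := @psi_ge (sep_level y z) (Num.max y z).
rewrite h le_max gt_max y0 y1 z1 => /(_ isT isT).
by rewrite leNgt lo_gt0.
Qed.

(** The outer points separate at level [minn a b]. If [b <= a], the triangle is isosceles with equal
    sides at [r] and base at most as long. If [a < b], the sides at [p] are [psi a q] and [psi a r];
    they differ by at most [lo b <= psi b r], since [q] and [r] share a cell of level [b]. *)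
Lemma cell_dist_triangle3 p q r : 0 <= p -> p < q -> q < r -> r < 1 ->
  [/\ cell_dist p r <= cell_dist p q + cell_dist q r,
      cell_dist p q <= cell_dist p r + cell_dist q r &
      cell_dist q r <= cell_dist p q + cell_dist p r].
Proof.
move=> p0 pq qr r1.
have q0 := le_trans p0 (ltW pq); have r0 := le_trans q0 (ltW qr).
have q1 := lt_trans qr r1; have p1 := lt_trans pq q1.
have pr := lt_trans pq qr.
rewrite !cell_distE//.
set a := sep_level p q; set b := sep_level q r; set d := sep_level p r.
have ha l : (l <= a)%N = (c l p == c l q) by apply: sep_levelP; rewrite ?lt_eqF.
have hb l : (l <= b)%N = (c l q == c l r) by apply: sep_levelP; rewrite ?lt_eqF.
have hd l : (l <= d)%N = (c l p == c l r) by apply: sep_levelP; rewrite ?lt_eqF.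
have dE : d = minn a b.
  apply/eqP; rewrite eqn_leq leq_min ha hb; apply/andP; split.
    have /eqP dpr : c d p == c d r by rewrite -hd.
    have dqr : c d q = c d r.
      apply: (cc d).2; last exact: ltW.
      by rewrite -dpr; exact: le_trans ((cc d).1 p) (ltW pq).
    by rewrite dpr dqr eqxx.
  have /eqP h1 : c (minn a b) p == c (minn a b) q by rewrite -ha geq_minl.
  have /eqP h2 : c (minn a b) q == c (minn a b) r by rewrite -hb geq_minr.
  by rewrite hd h1 h2.
have [ab|ba] := ltnP a b.
  have -> : d = a by rewrite dE; apply/minn_idPl/ltnW.
  have /eqP cqr : c b q == c b r by rewrite -hb.
  have := psi_osc ab q0 (ltW qr) r1 cqr.
  have := psi_ge b r0 r1; have := psi_mono a q0 (ltW qr) r1.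
  have := psi_le_lo ab r0 r1; have := psi_ge a q0 q1; have := lo_gt0 a; have := lo_gt0 b.
  by split; lra.
have -> : d = b by rewrite dE; apply/minn_idPr.
have : psi a q <= psi b r.
  move: ba; rewrite leq_eqVlt => /predU1P[->|ba]; first exact: (psi_mono _ q0 (ltW qr)).
  exact: le_trans (psi_le_lo ba q0 q1) (psi_ge b r0 r1).
have := psi_ge b r0 r1; have := psi_ge a q0 q1; have := lo_gt0 a; have := lo_gt0 b.
by split; lra.
Qed.

Lemma cell_dist_ge0 y z : 0 <= y -> y < 1 -> 0 <= z -> z < 1 -> 0 <= cell_dist y z.
Proof.
move=> y0 y1 z0 z1; rewrite /cell_dist; case: eqP => // _.
apply: le_trans (ltW (lo_gt0 (sep_level y z))) _.
by apply: psi_ge; rewrite ?le_max ?gt_max ?y0 ?y1 ?z1.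
Qed.

Lemma cell_dist_triangle y x z : 0 <= y -> y < 1 -> 0 <= x -> x < 1 ->
  0 <= z -> z < 1 -> cell_dist x z <= cell_dist x y + cell_dist y z.
Proof.
move=> y0 y1 x0 x1 z0 z1.
have [->|xz] := eqVneq x z.
  by rewrite cell_distxx addr_ge0// cell_dist_ge0.
have [->|yx] := eqVneq y x; first by rewrite cell_distxx add0r.
have [->|yz] := eqVneq y z; first by rewrite cell_distxx addr0.
have t := cell_dist_triangle3.
move: xz yx yz; rewrite !neq_lt => /orP[] xz /orP[] yx /orP[] yz; try lra.
- have [h1 h2 h3] := t _ _ _ y0 yx xz z1.
  by rewrite (cell_dist_sym x y); lra.
- by have [h1 h2 h3] := t _ _ _ x0 yx yz z1.
- have [h1 h2 h3] := t _ _ _ x0 xz yz y1.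
  by rewrite (cell_dist_sym y z); lra.
- have [h1 h2 h3] := t _ _ _ y0 yz xz x1.
  by rewrite (cell_dist_sym x z) (cell_dist_sym x y); lra.
- have [h1 h2 h3] := t _ _ _ z0 yz yx x1.
  by rewrite (cell_dist_sym x z) (cell_dist_sym x y) (cell_dist_sym y z); lra.
- have [h1 h2 h3] := t _ _ _ z0 xz yx y1.
  by rewrite (cell_dist_sym x z) (cell_dist_sym y z); lra.
Qed.

(** With the converse below, cells of level [l.+1] act as balls of radius [lo l], so topology and
    Cauchy filters can be read off the cells. *)
Lemma cell_dist_lt_lo y z l : 0 <= y -> y < 1 -> 0 <= z -> z < 1 ->
  cell_dist y z < lo l -> c l.+1 y = c l.+1 z.
Proof.
move=> y0 y1 z0 z1; have [->//|yz] := eqVneq y z.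
rewrite /cell_dist (negbTE yz) => h; apply/eqP; rewrite -sep_levelP// ltnNge.
apply/negP => lvl; move: h; rewrite ltNge => /negP; apply.
apply: le_trans (lo_homo lvl) _.
by apply: psi_ge; rewrite ?le_max ?gt_max ?y0 ?y1 ?z1.
Qed.

Lemma cell_dist_le_lo y z l : 0 <= y -> y < 1 -> 0 <= z -> z < 1 ->
  c l.+1 y = c l.+1 z -> cell_dist y z <= lo l.
Proof.
move=> y0 y1 z0 z1 cyz; rewrite /cell_dist; case: eqP => [_|/eqP yz]; first exact: ltW.
by apply: psi_le_lo; rewrite ?sep_levelP// ?cyz// ?le_max ?gt_max ?y0 ?y1 ?z1.
Qed.

Definition unit_interval := {x : R | 0 <= x < 1}.
Local Notation S := unit_interval.

Let val0 (x : S) : 0 <= val x. Proof. by have /andP[] := valP x. Qed.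
Let val1 (x : S) : val x < 1. Proof. by have /andP[] := valP x. Qed.

Definition unit_origin : S := exist _ 0 (introT andP (conj (lexx 0) ltr01)).

(* A Cauchy filter determines a decreasing sequence of cells; [cnr] keeps the
   right ends of these half-open intervals from accumulating, so that they
   contain a common point. *)
Lemma cell_dist_complete (F : set_system S) : ProperFilter F ->
    (forall e, 0 < e -> exists x : S, F [set y | cell_dist (val x) (val y) < e]) ->
  exists x : S, forall e, 0 < e -> F [set y | cell_dist (val x) (val y) < e].
Proof.
move=> FF cF.
have /choice[x xF] : forall l, exists x : S, F [set y | cell_dist (val x) (val y) < lo l].
  by move=> l; exact: cF.
pose A l := c l.+1 (val (x l)).
have AF l : F [set y : S | c l.+1 (val y) = A l].
  apply: filterS (xF l) => y /= h; symmetry; exact: (cell_dist_lt_lo (val0 _) (val1 _) (val0 _) (val1 _) h).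
have A2 l m : exists y : S, c l.+1 (val y) = A l /\ c m.+1 (val y) = A m.
  by have [y []] := filter_ex (filterI (AF l) (AF m)); exists y.
have Ahomo l m : (l <= m)%N -> A l <= A m.
  by move=> lm; have [y [<- <-]] := A2 l m; exact: cle_trans.
have A0 l : 0 <= A l.
  by rewrite -(c0 (val0 (x l)) (val1 (x l))); exact: cle_trans.
(* [u] is in the selected cell of level [l.+1] but to the right of the whole selected cell of level
   [l.+2], hence beyond all left ends [A m]. *)
have Abnd l : exists u : R, [/\ u < 1, c l.+1 u = A l & forall m, A m <= u].
  have [y [yl yl1]] := A2 l l.+1.
  have [u [yu u1 cu cu1]] := cnr l.+1 (val0 y) (val1 y).
  exists u; split=> // [|m]; first by rewrite cu.
  have [lm|ml] := leqP l.+1 m; last first.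
    apply: le_trans (Ahomo _ _ (ltnW ml)) _; rewrite -yl1.
    exact: le_trans ((cc _).1 _) (ltW yu).
  have [y' [y'l y'm]] := A2 l.+1 m.
  rewrite -y'm; apply: le_trans ((cc _).1 _) _; rewrite leNgt; apply/negP => uy'.
  have := cell_fun_homo (cc l.+2) (ltW uy').
  rewrite y'l -yl1 => h; have := le_trans h ((cc _).1 _).
  by rewrite leNgt cu1.
pose E := range A.
have Es : has_sup E.
  split; first by exists (A 0%N), 0%N.
  by have [u [_ _ Au]] := Abnd 0%N; exists u => _ [m _ <-].
pose w := sup E.
have Aw l : A l <= w by apply: (sup_upper_bound Es); exists l.
have wu (u : R) : (forall m, A m <= u) -> w <= u.
  by move=> Au; apply: ge_sup; [exact: Es.1|move=> _ [m _ <-]].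
have w0 : 0 <= w := le_trans (A0 0%N) (Aw 0%N).
have w1 : w < 1.
  by have [u [u1 _ /wu]] := Abnd 0%N => h; exact: le_lt_trans u1.
have cw l : c l.+1 w = A l.
  have [u [u1 cu Au]] := Abnd l; rewrite -cu.
  by apply: (cc _).2; [rewrite cu|exact: wu].
have w01 : 0 <= w < 1 by rewrite w0.
exists (exist _ w w01) => e e0.
have [l le] := lo_cvg e0.
apply: filterS (AF l) => y /= cy; apply: le_lt_trans le.
by apply: (cell_dist_le_lo w0 w1 (val0 _) (val1 _)); rewrite cw cy.
Qed.

Definition cell_complete_dist : complete_dist R unit_interval :=
  @CompleteDist R unit_interval (fun x y => cell_dist (val x) (val y))
    (fun x => cell_distxx (val x))
    (fun x y h => val_inj (cell_dist_pos (val0 x) (val1 x) (val0 y) (val1 y) h))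
    (fun x y => cell_dist_sym (val x) (val y))
    (fun y x z => cell_dist_triangle (val0 y) (val1 y) (val0 x) (val1 x) (val0 z) (val1 z))
    unit_origin cell_dist_complete.

End cell_distance.

(** * The law of the distance *)

Section quantile.
Context {R : realType} (P : probability (measurableTypeR R) R).
Local Open Scope measure_display_scope.

(** The identity as a random variable with law [P], through which facts about [cdf] apply to
    [dist_fun]. *)
Let idR : measurableTypeR R -> R := idfun.

#[local] HB.instance Definition _ :=
  @isMeasurableFun.Build _ _ _ _ idR (@measurable_id _ _ setT).

Definition dist_fun (x : R) : R := fine (P `]-oo, x]%classic).

Lemma dist_funE x : (dist_fun x)%:E = P `]-oo, x]%classic.
Proof. by rewrite /dist_fun fineK// fin_num_measure. Qed.

Lemma dist_fun_cdf : EFin \o dist_fun = cdf (idR : {RV P >-> R}).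
Proof.
apply/funext => x; rewrite /= dist_funE /cdf /distribution /pushforward.
by rewrite preimage_id.
Qed.

Lemma dist_fun_homo : {homo dist_fun : x y / x <= y}.
Proof.
move=> x y xy; rewrite -lee_fin !dist_funE le_measure ?inE//.
by apply: subset_itvl; rewrite bnd_simp.
Qed.

Lemma dist_fun_ge0 x : 0 <= dist_fun x.
Proof. by rewrite -lee_fin dist_funE. Qed.

Lemma dist_fun_le1 x : dist_fun x <= 1.
Proof. by rewrite -lee_fin dist_funE probability_le1. Qed.

Lemma dist_fun_right x e : 0 < e -> exists2 y, x < y & dist_fun y < dist_fun x + e.
Proof.
move=> e0; have := @cdf_right_continuous _ _ _ _ (idR : {RV P >-> R}) x.
rewrite -dist_fun_cdf => /fine_cvg /=.
move=> /cvgrPdist_lt /(_ _ e0) h.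
near x^'+ => y; exists y; first by near: y; exact: nbhs_right_gt.
have : `|dist_fun x - dist_fun y| < e by near: y.
by have := ler_norm (dist_fun y - dist_fun x); rewrite distrC; lra.
Unshelve. all: by end_near. Qed.

Lemma dist_fun_cvg1 v : v < 1 -> exists x, v < dist_fun x.
Proof.
move=> v1; have := @cvg_cdfy1 _ _ _ _ (idR : {RV P >-> R}).
rewrite -dist_fun_cdf => /fine_cvg /=.
move=> /cvgrPdist_lt /(_ (1 - v)); rewrite subr_gt0 => /(_ v1) h.
near (pinfty_nbhs R) => y; exists y.
have : `|1 - dist_fun y| < 1 - v by near: y.
by have := ler_norm (1 - dist_fun y); lra.
Unshelve. all: by end_near. Qed.

(** The strict inequality selects the right-continuous version. *)
Definition quantile (v : R) : R := inf [set x | v < dist_fun x].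

Hypothesis P0 : dist_fun 0 = 0.

Let lb v : 0 < v -> lbound [set x | v < dist_fun x] 0.
Proof.
move=> v0 x /= vx; rewrite leNgt; apply/negP => /ltW /dist_fun_homo.
by rewrite P0; lra.
Qed.

Let hinf v : 0 < v -> v < 1 -> has_inf [set x | v < dist_fun x].
Proof. by move=> v0 v1; split; [exact: dist_fun_cvg1|exists 0; exact: lb]. Qed.

Lemma quantile_le v x : 0 < v -> v < dist_fun x -> quantile v <= x.
Proof. by move=> v0 vx; apply: ge_inf => //; exists 0; exact: lb. Qed.

(** Right continuity of [dist_fun] leaves room to the right of [x], whence the strict inequality.
    With [quantile_le] this settles every comparison except [dist_fun x = v]. *)
Lemma quantile_gt v x : 0 < v -> v < 1 -> dist_fun x < v -> x < quantile v.
Proof.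
move=> v0 v1 xv; have e0 : 0 < v - dist_fun x by lra.
have [y xy hy] := dist_fun_right x e0.
apply: (lt_le_trans xy); apply: lb_le_inf; first exact: dist_fun_cvg1.
move=> z /= vz; rewrite leNgt; apply/negP => /ltW /dist_fun_homo; lra.
Qed.

Lemma quantile_homo x y : 0 < x -> x <= y -> y < 1 -> quantile x <= quantile y.
Proof.
move=> x0 xy y1; apply: lb_le_inf; first exact: dist_fun_cvg1.
by move=> z /= yz; apply: quantile_le => //; lra.
Qed.

Lemma quantile_right x e : 0 < x -> x < 1 -> 0 < e ->
  exists2 y, x < y < 1 & quantile y <= quantile x + e.
Proof.
move=> x0 x1 e0; have [z /= xz zx] := inf_adherent e0 (hinf x0 x1).
have z1 := dist_fun_le1 z.
exists ((x + dist_fun z) / 2); first by apply/andP; split; lra.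
by apply: le_trans (ltW zx); apply: quantile_le; lra.
Qed.

Lemma quantile_gt0 x : 0 < x -> x < 1 -> 0 < quantile x.
Proof. by move=> x0 x1; apply: quantile_gt => //; rewrite P0. Qed.

End quantile.

Lemma probability_eq_dist_fun (R : realType)
    (P P' : probability (measurableTypeR R) R) :
  dist_fun P =1 dist_fun P' -> forall A, measurable A -> P A = P' A.
Proof.
move=> PP' A mA.
have G1 x : P `]x, +oo[%classic = P' `]x, +oo[%classic.
  by rewrite -setCitvl !probability_setC// -!dist_funE PP'.
have := @measure_unique _ R (measurableTypeR R) (@RGenOInfty.G R)
  (fun n : nat => `](- n%:R)%R, +oo[%classic) _ _ _ _ P P' _ _ A mA.
apply => //.
- exact: RGenOInfty.measurableE.
- move=> _ _ [x ->] [y ->]; exists (Num.max x y).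
  by apply/seteqP; split => z /=; rewrite !in_itv/= !andbT gt_max => /andP.
- by move=> n; exists (- n%:R).
- apply/seteqP; split => // x _; exists (Num.truncn `|x|).+1 => //=.
  rewrite in_itv/= andbT ltrNl (le_lt_trans _ (truncnS_gt _))//.
  by rewrite -normrN ler_norm.
- by move=> _ [x ->]; exact: G1.
- by move=> n; rewrite ltey_eq fin_num_measure.
Qed.

(** * The uniform law on the unit interval *)

Section unit_interval_measure.
Context {R : realType}.

Definition unit_prob : probability (measurableTypeR R) R := uniform_prob (@ltr01 R).

Lemma unit_prob_itv (a b : R) : 0 <= a -> a <= b -> b <= 1 ->
  unit_prob `[a, b[%classic = (b - a)%:E.
Proof.
move=> a0 ab b1; rewrite /unit_prob/= /uniform_prob.
rewrite (eq_integral (fun=> 1%E)); last first.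
  move=> x; rewrite inE/= in_itv/= /uniform_pdf subr0 invr1 => /andP[ax xb].
  by rewrite (le_trans a0 ax) (le_trans (ltW xb) b1).
rewrite integral_cst//= mul1e lebesgue_measure_itv/= lte_fin.
by case: ltP => // ba; rewrite (le_anti (introT andP (conj ab ba))) subrr.
Qed.

Lemma unit_prob_set1 (a : R) : unit_prob [set a] = 0%E.
Proof.
rewrite /unit_prob/= /uniform_prob; apply: integral_set1.
Qed.

(** Makes points of [[0, 1[] out of all reals; only a null set for [unit_prob] is moved. *)
Definition clip (x : R) : R := if 0 <= x < 1 then x else 0.

Lemma clip_ge0 x : 0 <= clip x.
Proof. by rewrite /clip; case: ifP => // /andP[]. Qed.

Lemma clip_lt1 x : clip x < 1.
Proof. by rewrite /clip; case: ifP => // /andP[]. Qed.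

Lemma clip_id x : 0 <= x -> x < 1 -> clip x = x.
Proof. by rewrite /clip => -> ->. Qed.

Lemma measurable_clip : measurable_fun [set: measurableTypeR R] clip.
Proof.
apply: measurable_fun_if => //.
- apply: measurable_and.
    by apply: measurable_fun_ler => //; exact: measurable_id.
  by apply: measurable_fun_ltr => //; exact: measurable_id.
Qed.

Lemma mono_on_measurable (f : R -> R) : mono_on 0 1 f ->
  measurable_fun (`[0%R, 1[%classic : set (measurableTypeR R)) f.
Proof.
move=> fm.
apply: (measurability (@RGenCInfty.G R)) => [|/= _ [_] [r] -> <-].
  exact: RGenCInfty.measurableE.
apply: is_interval_measurable => s t/= [] + + [].
rewrite !in_itv/= !andbT => /andP[s0 s1] fs /andP[t0 t1] ft u /andP[su ut].
have u0 := le_trans s0 su; have u1 := le_lt_trans ut t1.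
by rewrite !in_itv/= !andbT u0 u1; split => //; rewrite (le_trans fs)// fm.
Qed.

End unit_interval_measure.

(** * Measurability of the distance *)

Section cell_dist_measurable.
Context {R : realType}.
Variables (c psi : nat -> R -> R).
Hypotheses (cc : forall l, cell_fun (c l))
  (c0 : forall y, 0 <= y -> y < 1 -> c 0%N y = 0)
  (cle : forall l y, c l y <= c l.+1 y)
  (csep : forall y z, 0 <= y -> y < z -> z < 1 -> exists l, c l y != c l z)
  (psi_mono : forall l, mono_on 0 1 (psi l)).

Local Notation RR := (measurableTypeR R * measurableTypeR R)%type.

Definition clip_dist (w : RR) : measurableTypeR R :=
  cell_dist c psi (clip w.1) (clip w.2).

(** The plane splits into the pairs with equal clipped coordinates and, for each [l], the pairs
    separating at level [l], on which the distance is [psi l] of the maximum. *)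
Lemma measurable_clip_dist : measurable_fun [set: RR] clip_dist.
Proof.
pose y (w : RR) : measurableTypeR R := clip w.1.
pose z (w : RR) : measurableTypeR R := clip w.2.
have my : measurable_fun setT y.
  exact: measurableT_comp measurable_clip measurable_fst.
have mz : measurable_fun setT z.
  exact: measurableT_comp measurable_clip measurable_snd.
have mc l : measurable_fun [set: measurableTypeR R] (c l).
  by apply: nondecreasing_measurable => //; exact: cell_fun_homo.
pose eqc l := [set w | c l (y w) = c l (z w)].
have measurable_eqr (f g : RR -> measurableTypeR R) : measurable_fun setT f ->
    measurable_fun setT g -> measurable [set w | f w = g w].
  move=> mf mg; have := measurable_funB mf mg measurableT (measurable_set1 0).
  rewrite setTI; congr measurable; apply/seteqP; split => w /= /eqP.
    by rewrite subr_eq0 => /eqP.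
  by rewrite -subr_eq0 => /eqP.
have meqc l : measurable (eqc l).
  apply: measurable_eqr.
    exact: measurableT_comp (mc l) my.
  exact: measurableT_comp (mc l) mz.
have meq : measurable [set w | y w = z w].
  exact: measurable_eqr.
pose yz (w : RR) : measurableTypeR R := Num.max (y w : R) (z w : R).
have mpsi l : measurable_fun [set: RR] ((psi l : measurableTypeR R -> measurableTypeR R) \o yz).
  apply: (@measurable_comp _ _ _ RR (measurableTypeR R) (measurableTypeR R)
    `[0%R, 1[%classic (psi l) setT yz) => //.
  - move=> _ [w _ <-] /=; rewrite in_itv/= le_max gt_max.
    by rewrite clip_ge0 !clip_lt1.
  - exact: mono_on_measurable.
  - exact: measurable_maxr.
move=> _ B mB; rewrite setTI.
have -> : clip_dist @^-1` B =
    ([set w | y w = z w] `&` [set w | B 0]) `|`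
    \bigcup_l ((~` [set w | y w = z w] `&` (eqc l `\` eqc l.+1)) `&`
      (psi l \o yz) @^-1` B).
  have lv w : y w != z w -> forall l, (l <= sep_level c (y w) (z w))%N = (c l (y w) == c l (z w)).
    by move=> ne l; apply: sep_levelP => //; rewrite ?clip_ge0 ?clip_lt1.
  have DE w : clip_dist w = if y w == z w then 0 else psi (sep_level c (y w) (z w)) (yz w).
    by [].
  apply/seteqP; split => w; rewrite /preimage /mkset DE.
    case: eqP => [e B0|/eqP ne Bw]; first by left.
    right; exists (sep_level c (y w) (z w)) => //; split => //; split; first exact/eqP.
    by split; apply/eqP; rewrite -lv// ltnn.
  case=> [[/= -> B0]|[l _ [[/eqP ne [/eqP h1 /eqP h2]] Bl]]]; first by rewrite eqxx.
  rewrite (negbTE ne); have -> // : sep_level c (y w) (z w) = l.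
  by apply/eqP; rewrite eqn_leq leqNgt !lv// h1 andbT.
apply: measurableU.
  apply: measurableI => //; have [B0|nB0] := pselect (B 0).
    by rewrite (_ : [set _ | _] = setT)//; apply/seteqP; split.
  by rewrite (_ : [set _ | _] = set0)//; apply/seteqP; split.
apply: bigcupT_measurable => l; apply: measurableI.
  by apply: measurableI; [exact: measurableC|exact: measurableD].
by rewrite -[X in measurable X]setTI; exact: mpsi.
Qed.

End cell_dist_measurable.

Lemma phi_cvg (R : realType) (e : R) : 0 < e -> exists l, phi l < e.
Proof.
move=> e0; have phil l : phi l <= l.+1%:R^-1 :> R.
  elim: l => [|l IH]; first by rewrite /phi expr0 invr1.
  rewrite phiS; apply: (@le_trans _ _ (l.+1%:R^-1 / 2)); first by rewrite ler_pM2r.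
  rewrite -invfM lef_pV2 ?posrE ?mulr_gt0// ?ltr0n// -natrM ler_nat; lia.
exists (Num.truncn e^-1); apply: le_lt_trans (phil _) _.
by rewrite -[ltRHS]invrK ltf_pV2 ?posrE ?invr_gt0// ?ltr0n// truncnS_gt.
Qed.

(** * The area of the pairs of height at most a given value *)

Section area.
Context {R : realType}.
Variable c : nat -> R -> R.
Hypotheses (cc : forall l, cell_fun (c l))
  (c0 : forall y, 0 <= y -> y < 1 -> c 0%N y = 0)
  (cle : forall l y, c l y <= c l.+1 y)
  (cprim : forall l, prim (c l) 1 = (1 - phi l) / 2).

Let V l := height (phi l.+1) (c l) (c l.+1).
Hypothesis V_itv : forall l y, 0 <= y -> y < 1 -> phi l.+1 <= V l y < phi l.

Let chomo l := cell_fun_homo (cc l).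

(** If [y] and [z] shared all cells, so would all pairs of points between them, and [phi l] would be
    at least [(z - y) ^+ 2] for every [l]. *)
Lemma cells_separate y z : 0 <= y -> y < z -> z < 1 -> exists l, c l y != c l z.
Proof.
move=> y0 yz z1; apply: contrapT => h.
have cE l : c l y = c l z.
  by apply/eqP; apply: contrapT => /negP ne; apply: h; exists l.
have yz0 : 0 < (z - y) ^+ 2 by rewrite exprn_gt0// subr_gt0.
have [l] := phi_cvg yz0; rewrite ltNge => /negP; apply.
have idm : {homo (@id R) : x y / x <= y} by [].
have zm : {homo (fun=> 0 : R) : x y / x <= y :> R} by [].
have le1 x : 0 <= x -> x < y -> c l x <= id x + 0 by rewrite addr0 => _ _; exact: (cc l).1.
have le3 x : z <= x -> x < 1 -> c l x <= id x + 0 by rewrite addr0 => _ _; exact: (cc l).1.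
have le2 x : y <= x -> x < z -> c l x <= 0 + y.
  by move=> _ xz; rewrite add0r (le_trans (chomo l (ltW xz)))// -cE; exact: (cc l).1.
have z0 := le_trans y0 (ltW yz).
have := ler_primB (@chomo l) idm (lexx 0) y0 le1.
have := ler_primB (@chomo l) zm y0 (ltW yz) le2.
have := ler_primB (@chomo l) idm z0 (ltW z1) le3.
have p0 u : prim (fun=> 0 : R) u = 0 by rewrite /prim Rintegral_cst// mul0r.
rewrite !p0 !prim0 cprim !prim_id ?mul0r//; lra.
Qed.

Lemma eq_primB (f g : R -> R) (s t : R) : {homo f : x y / x <= y} ->
    {homo g : x y / x <= y} -> 0 <= s -> s <= t ->
    (forall x, s < x -> x < t -> f x = g x) ->
  prim f t - prim f s = prim g t - prim g s.
Proof.
move=> fm gm s0 st fg; rewrite !primB//.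
have sub : `]s, t[%classic `<=` `[s, t[%classic.
  by apply: subset_itvr; rewrite bnd_simp.
rewrite -!Rintegral_itv_obnd_cbnd; last 2 first.
- by apply: integrableS (nondecreasing_integrable s t gm).
- by apply: integrableS (nondecreasing_integrable s t fm).
by apply: eq_Rintegral => x; rewrite inE/= in_itv/= => /andP[sx xt]; exact: fg.
Qed.

Let V_mono l y z : 0 <= y -> y <= z -> V l y <= V l z.
Proof. exact: height_homo. Qed.

Let cge0 l y : 0 <= y -> 0 <= c l y.
Proof.
move=> y0; suff h : 0 <= c l 0 by apply: le_trans h (chomo l y0).
by elim: l => [|l IH]; [rewrite c0|exact: le_trans (cle l 0)].
Qed.

Let V_lip l y z : 0 <= y -> y <= z -> z <= 1 -> V l z <= V l y + 2 * (z - y).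
Proof. by move=> y0; apply: height_lip => // x; exact: cge0. Qed.

Let V1 l : V l 1 = phi l.
Proof. by rewrite /V /height !cprim phiS; field. Qed.

Let V0 l : V l 0 = phi l.+1.
Proof. by rewrite /V /height !prim0; ring. Qed.

(** An intermediate value; the last point of height at most [v] is taken, so that heights to its
    right exceed [v]. *)
Lemma height_preimage l (v : R) : phi l.+1 <= v -> v < phi l ->
  exists t, [/\ 0 <= t, t < 1, V l t = v & forall x, t < x -> x < 1 -> v < V l x].
Proof.
move=> vl vl'.
pose E := [set t | [/\ 0 <= t, t <= 1 & V l t <= v]].
have E0 : E 0 by split; rewrite ?V0.
have Es : has_sup E by split; [exists 0|exists 1 => t []].
pose t := sup E.
have t0 : 0 <= t by apply: (sup_upper_bound Es).
have t1 : t <= 1 by apply: ge_sup; [exists 0|move=> x []].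
have tv : V l t <= v.
  rewrite leNgt; apply/negP => h; have e0 : 0 < (V l t - v) / 2 by lra.
  have [x [x0 x1 xv] tx] := sup_adherent e0 Es.
  have xt : x <= t by apply: (sup_upper_bound Es).
  by have := V_lip l x0 xt t1; rewrite -/t in tx; lra.
have t1' : t < 1.
  by rewrite lt_neqAle t1 andbT; apply/negP => /eqP e; rewrite e V1 in tv; lra.
have gt x : t < x -> x < 1 -> v < V l x.
  move=> tx x1; rewrite ltNge; apply/negP => xv.
  have : x <= t by apply: (sup_upper_bound Es); split => //; lra.
  by rewrite leNgt tx.
exists t; split => //; apply: le_anti; rewrite tv/= leNgt; apply/negP => h.
pose x := Num.min ((t + 1) / 2) (t + (v - V l t) / 2).
have tx : t < x by rewrite lt_min; apply/andP; split; lra.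
have x1 : x <= (t + 1) / 2 by rewrite ge_min lexx.
have x2 : x <= t + (v - V l t) / 2 by rewrite ge_min lexx orbT.
have x1' : x < 1 by lra.
by have := V_lip l t0 (ltW tx) (ltW x1'); have := gt x tx x1'; lra.
Qed.

Lemma phi_level (v : R) : 0 < v -> v < 1 -> exists l, phi l.+1 <= v < phi l.
Proof.
move=> v0 v1; have ex : exists l, phi l.+1 <= v.
  have [l lv] := phi_cvg v0; exists l.
  by apply: le_trans (ltW lv); exact: phi_homo.
have [l lv lmin] := ex_minnP ex; exists l; rewrite lv/=.
case: l lv lmin => [|l] _ lmin; first by rewrite /phi expr0.
by rewrite ltNge; apply/negP => /lmin; rewrite ltnn.
Qed.

Let csep := cells_separate.

(* The points at height at most [v] below [t] form an interval ending at [t],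
   whatever [t] is; this is why the law of the height is uniform. *)
Lemma height_section (v : R) : 0 < v -> v < 1 -> exists a : R -> R,
  [/\ {homo a : x y / x <= y}, prim a 1 = (1 - v) / 2,
    forall t, 0 <= t -> 0 <= a t <= t &
    forall s t, 0 <= s -> s < t -> t < 1 -> (cell_dist c V s t <= v) = (a t <= s)].
Proof.
move=> v0 v1; have [k /andP[vk vk']] := phi_level v0 v1.
have [t [t0 t1 tv gt]] := height_preimage vk vk'.
(* Height at most [v] means sharing a cell of level [k.+1], or separating at level [k] with larger
   point at most [t]. *)
pose a x := if x <= t then c k x else c k.+1 x.
have am : {homo a : x y / x <= y}.
  move=> x y xy; rewrite /a; case: ifPn => xt; case: ifPn => yt.
  - exact: chomo.
  - exact: le_trans (chomo k xy) (cle k y).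
  - by move: xt; rewrite (le_trans xy yt).
  - exact: chomo.
exists a; split => //.
(* The integrand switches from [c k] to [c k.+1] at [t], and [V k t = v] evaluates the result. *)
- have h1 := @eq_primB a (c k) 0 t am (@chomo k) (lexx 0) t0 _.
  have h2 := @eq_primB a (c k.+1) t 1 am (@chomo k.+1) t0 (ltW t1) _.
  have {}h1 := h1 (fun x _ xt => ltac:(by rewrite /a (ltW xt))).
  have {}h2 := h2 (fun x tx _ => ltac:(by rewrite /a leNgt tx)).
  move: tv h1 h2; rewrite /V /height !prim0 !cprim phiS; lra.
- by move=> x x0; rewrite /a; case: ifP => _; rewrite cge0// (cc _).1.
move=> s u s0 su u1.
have u0 := le_trans s0 (ltW su); have s1 := lt_trans su u1.
rewrite cell_distE//; set m := sep_level c s u.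
have hm l : (l <= m)%N = (c l s == c l u).
  by apply: sep_levelP => //; rewrite lt_eqF.
have csu l : (c l s == c l u) = (c l u <= s).
  apply/eqP/idP => [<-|h]; first exact: (cc l).1.
  by apply: (cc l).2 => //; exact: ltW.
have [mk|km|mk] := ltngtP m k.
- have -> : (V m u <= v) = false.
    apply/negbTE; rewrite -ltNge; have /andP[h _] := V_itv m u0 u1.
    exact: lt_le_trans vk' (le_trans (phi_homo mk) h).
  apply/esym/negbTE; rewrite -ltNge /a.
  have h : s < c k u by rewrite ltNge -csu -hm -ltnNge.
  by case: ifP => // _; exact: lt_le_trans h (cle k u).
- have -> : V m u <= v.
    have /andP[_ h] := V_itv m u0 u1.
    exact: le_trans (ltW h) (le_trans (phi_homo km) vk).
  have h : c k.+1 u <= s by rewrite -csu -hm.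
  by apply/esym; rewrite /a; case: ifP => // _; exact: le_trans (cle k u) h.
- rewrite mk /a; case: (leP u t) => ut.
    have -> : V k u <= v by rewrite -tv V_mono.
    by rewrite -csu -hm mk leqnn.
  rewrite leNgt gt//=; apply/esym/negbTE.
  by rewrite -csu -hm mk ltnn.
Qed.

End area.

(** * The product measure on the unit square *)

Section square.
Context {R : realType}.
Local Notation mu := (@unit_prob R).
Local Notation RR := (measurableTypeR R * measurableTypeR R)%type.

Definition square_prob : probability RR R := (mu \x mu)%E.

Lemma square_prob_swap (X : set RR) : measurable X ->
  square_prob ((fun w : RR => (w.2, w.1)) @^-1` X) = square_prob X.
Proof.
move=> mX; have mY : measurable ((fun w : RR => (w.2, w.1)) @^-1` X).
  by rewrite -[X in measurable X]setTI; exact: measurable_swap.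
rewrite /square_prob/= (@product_measure_unique _ _ _ _ R mu mu (mu \x^ mu)%E _ _ mY); last first.
  by move=> A B mA mB; rewrite [LHS]product_measure2E.
by apply: eq_integral => y _ /=; congr (mu _).
Qed.

Lemma square_prob_diag : square_prob [set w | w.1 = w.2] = 0%E.
Proof.
rewrite /square_prob/= /product_measure1 integral0_eq// => x _ /=.
rewrite (_ : xsection _ _ = [set x]) ?unit_prob_set1//.
by apply/seteqP; split => y; [move/xsectionP => /= ->|move=> /= ->; apply/xsectionP].
Qed.

Lemma measurable_diag : measurable [set w : RR | w.1 = w.2].
Proof.
have := measurable_funB (@measurable_fst _ _ (measurableTypeR R) (measurableTypeR R))
  (@measurable_snd _ _ (measurableTypeR R) (measurableTypeR R)) measurableT (measurable_set1 0).
rewrite setTI; congr measurable; apply/seteqP; split => w /= /eqP.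
  by rewrite subr_eq0 => /eqP.
by rewrite -subr_eq0 => /eqP.
Qed.

Definition unit_square : set RR := `[0%R, 1[%classic `*` `[0%R, 1[%classic.

Lemma square_prob_unitC : square_prob (~` unit_square) = 0%E.
Proof.
have mS : measurable unit_square by apply: measurableX.
have h : square_prob unit_square = (mu `[0%R, 1%R[%classic * mu `[0%R, 1%R[%classic)%E.
  exact: product_measure1E.
by rewrite probability_setC// h !unit_prob_itv// subr0 mule1 subee.
Qed.

(** The first coordinate is the larger point, so that sections over it are the intervals [[a t,
    t[]. *)
Definition below_diag (a : R -> R) : set RR :=
  [set w | 0 <= w.1 < 1 /\ a w.1 <= w.2 < w.1].

Lemma measurable_below_diag (a : R -> R) : {homo a : x y / x <= y} ->
  measurable (below_diag a).
Proof.
move=> am; have ma : measurable_fun [set: measurableTypeR R] a.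
  exact: nondecreasing_measurable.
have m1 : measurable_fun [set: RR] fst by [].
have m2 : measurable_fun [set: RR] snd by [].
have -> : below_diag a = ((fun w : RR => (0 <= w.1 < 1) && (a w.1 <= w.2 < w.1)) @^-1` [set true]).
  by apply/seteqP; split => w /=; [move=> [-> ->]|move/andP].
rewrite -[X in measurable X]setTI.
suff : measurable_fun [set: RR] (fun w : RR => (0 <= w.1 < 1) && (a w.1 <= w.2 < w.1)).
  by apply.
apply: measurable_and; apply: measurable_and.
- by apply: measurable_fun_ler.
- by apply: measurable_fun_ltr.
- by apply: measurable_fun_ler => //; exact: measurableT_comp ma m1.
- by apply: measurable_fun_ltr.
Qed.

Lemma square_prob_below_diag (a : R -> R) : {homo a : x y / x <= y} ->
    (forall t, 0 <= t -> 0 <= a t <= t) ->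
  square_prob (below_diag a) = (1 / 2 - prim a 1)%:E.
Proof.
move=> am a0; have mB := measurable_below_diag am.
rewrite /square_prob/= /product_measure1.
have sE x : 0 <= x -> x < 1 -> mu (xsection (below_diag a) x) = (x - a x)%:E.
  move=> x0 x1; rewrite (_ : xsection _ _ = `[a x, x[%classic); last first.
    apply/seteqP; split => y; first by move/xsectionP => -[_]; rewrite /= in_itv.
    by rewrite /= in_itv/= => h; apply/xsectionP; split => //=; rewrite x0.
  by have /andP[h1 h2] := a0 _ x0; rewrite unit_prob_itv// ltW.
rewrite integral_uniform//; last exact: measurable_fun_xsection.
rewrite subr0 invr1 mul1e -integral_itv_bndo_bndc; last first.
  by apply: measurable_funTS; exact: measurable_fun_xsection.
rewrite (eq_integral (fun x : measurableTypeR R => ((x : R) - a x)%:E)); last first.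
  by move=> x; rewrite inE/= in_itv/= => /andP[x0 x1]; exact: sE.
have idm : {homo (@id R) : x y / x <= y} by [].
have i1 := nondecreasing_integrable 0 1 idm.
have i2 := nondecreasing_integrable 0 1 am.
have h : (\int[lebesgue_measure]_(x in `[0%R, 1[) (id x - a x))%R = prim id 1 - prim a 1.
  exact: RintegralB.
rewrite prim_id// expr1n in h; rewrite -h.
rewrite /Rintegral fineK//.
apply: integrable_fin_num => //.
exact: (integrableB _ i1 i2).
Qed.

End square.

(** * The laws of the height and of the distance *)

Section law.
Context {R : realType}.
Variable c : nat -> R -> R.
Hypotheses (cc : forall l, cell_fun (c l))
  (c0 : forall y, 0 <= y -> y < 1 -> c 0%N y = 0)
  (cle : forall l y, c l y <= c l.+1 y)
  (cprim : forall l, prim (c l) 1 = (1 - phi l) / 2).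
Let V l := height (phi l.+1) (c l) (c l.+1).
Hypothesis V_itv : forall l y, 0 <= y -> y < 1 -> phi l.+1 <= V l y < phi l.

Let csep := cells_separate cc cprim.

Lemma height_mono l : mono_on 0 1 (V l).
Proof. by move=> y z y0 yz _; exact: height_homo. Qed.

(** Up to the null set formed by the diagonal and the complement of the unit square, the event is
    [below_diag a] together with its mirror image, each of probability [v / 2]. *)
Lemma height_law (v : R) : 0 < v -> v < 1 ->
  square_prob [set w | clip_dist c V w <= v] = v%:E.
Proof.
move=> v0 v1; have [a [am pa a0 aP]] := height_section cc c0 cle cprim V_itv v0 v1.
set E := [set w | _].
have mE : measurable E.
  rewrite (_ : E = clip_dist c V @^-1` `]-oo, v]%classic).
    rewrite -[X in measurable X]setTI.
    exact: (measurable_clip_dist cc c0 cle csep height_mono).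
  by apply/seteqP; split => w; rewrite /= in_itv.
pose B := below_diag a.
pose B' := (fun w : measurableTypeR R * measurableTypeR R => (w.2, w.1)) @^-1` B.
have mB : measurable B := measurable_below_diag am.
have mB' : measurable B'.
  by rewrite -[X in measurable X]setTI; exact: measurable_swap.
have PB : square_prob B = (v / 2)%:E.
  by rewrite square_prob_below_diag// pa; congr EFin; field.
have PB' : square_prob B' = (v / 2)%:E by rewrite square_prob_swap.
have BP s t : 0 <= s -> 0 <= t -> s < 1 -> t < 1 -> s < t ->
    (cell_dist c V s t <= v) = (a t <= s).
  by move=> s0 t0 s1 t1 st; apply: aP.
apply/eqP; rewrite eq_le; apply/andP; split.
- pose N := [set w : measurableTypeR R * measurableTypeR R | w.1 = w.2] `|` ~` unit_square.
  have mN : measurable N.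
    by apply: measurableU; [exact: measurable_diag|apply: measurableC; exact: measurableX].
  have PN : square_prob N = 0%E.
    apply/eqP; rewrite eq_le measure_ge0 andbT.
    apply: le_trans (measureU2 _ _ _) _; first exact: measurable_diag.
      by apply: measurableC; exact: measurableX.
    by rewrite [X in (X + _)%E]square_prob_diag [X in (_ + X)%E]square_prob_unitC adde0.
  have sub : E `<=` (B `|` B') `|` N.
    move=> [t s]; rewrite /E /= /clip_dist /=.
    have [[/= + +]|] := pselect (unit_square (t, s)); last by move=> h _; right; right.
    rewrite !in_itv/= => /andP[t0 t1] /andP[s0 s1]; rewrite !clip_id//.
    have [st|ts|->] := ltgtP s t; last by move=> _; right; left.
      rewrite cell_dist_sym BP// => h; left; left.
      by split => /=; rewrite ?t0 ?h.
    rewrite BP// => h; left; right.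
    by split => /=; rewrite ?s0 ?h.
  apply: (@le_trans _ _ (square_prob ((B `|` B') `|` N))).
    by apply: le_measure; rewrite ?inE//; apply: measurableU => //; exact: measurableU.
  apply: le_trans (measureU2 _ _ _) _ => //; first exact: measurableU.
  rewrite [X in (_ + X)%E]PN adde0; apply: le_trans (measureU2 _ _ _) _ => //.
  by rewrite [X in (X + _)%E]PB [X in (_ + X)%E]PB' -EFinD lee_fin; lra.
- have <- : square_prob (B `|` B') = v%:E.
    have -> : square_prob (B `|` B') = (square_prob B + square_prob B')%E.
      apply: measureU => //; apply/seteqP; split => // -[t s].
      move=> [[_ /andP[_ /= h1]] [_ /andP[_ /= h2]]].
      by have := lt_trans h1 h2; rewrite ltxx.
    by rewrite PB PB' -EFinD; congr EFin; lra.
  apply: le_measure; rewrite ?inE//; first exact: measurableU.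
  move=> [t s] [[/= /andP[t0 t1] /andP[h1 h2]]|[/= /andP[s0 s1] /andP[h1 h2]]].
    have /andP[a1 _] := a0 _ t0; have s0 := le_trans a1 h1; have s1 := lt_trans h2 t1.
    by rewrite /E /= /clip_dist /= !clip_id// cell_dist_sym BP.
  have /andP[a1 _] := a0 _ s0; have t0 := le_trans a1 h1; have t1 := lt_trans h2 s1.
  by rewrite /E /= /clip_dist /= !clip_id// BP.
Qed.

Variable P : probability (measurableTypeR R) R.
Hypotheses (P0 : dist_fun P 0 = 0).
Let Q := quantile P.

Lemma psi_mono_on l : mono_on 0 1 (Q \o V l).
Proof.
apply: (@mono_on_comp _ Q (quantile_homo P0) (V l)) => [y y0 y1|]; last exact: height_mono.
have /andP[h1 h2] := V_itv l y0 y1.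
by rewrite (lt_le_trans (phi_gt0 _) h1) (lt_le_trans h2 (phi_le1 l)).
Qed.

(** Off the diagonal the distance is [Q] of the height. Comparing the event with that of height at
    most [v], for [v] below and then above [dist_fun P x], bounds its probability from both sides
    without meeting the case of equality. *)
Lemma dist_law x :
  square_prob [set w | clip_dist c (fun l => Q \o V l) w <= x] = (dist_fun P x)%:E.
Proof.
set E := [set w | _].
have mE : measurable E.
  rewrite (_ : E = clip_dist c (fun l => Q \o V l) @^-1` `]-oo, x]%classic).
    rewrite -[X in measurable X]setTI.
    exact: (measurable_clip_dist cc c0 cle csep psi_mono_on).
  by apply/seteqP; split => w; rewrite /= in_itv.
have mV v : measurable [set w | clip_dist c V w <= v].
  rewrite (_ : [set _ | _] = clip_dist c V @^-1` `]-oo, v]%classic).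
    rewrite -[X in measurable X]setTI.
    exact: (measurable_clip_dist cc c0 cle csep height_mono).
  by apply/seteqP; split => w; rewrite /= in_itv.
have Vpos m (y z : R) : 0 <= y -> y < 1 -> 0 <= z -> z < 1 ->
    0 < V m (Num.max y z) /\ V m (Num.max y z) < 1.
  move=> y0 y1 z0 z1; have /andP[h1 h2] : phi m.+1 <= V m (Num.max y z) < phi m.
    by apply: V_itv; rewrite ?le_max ?gt_max ?y0 ?y1 ?z1.
  split; first exact: lt_le_trans (phi_gt0 _) h1.
  exact: lt_le_trans h2 (phi_le1 m).
pose p := fine (square_prob E).
have pE : square_prob E = p%:E by rewrite /p fineK// fin_num_measure.
have p0 : 0 <= p by rewrite -lee_fin -pE.
have p1 : p <= 1 by rewrite -lee_fin -pE probability_le1.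
have F0 := dist_fun_ge0 P x; have F1 := dist_fun_le1 P x.
have lo v : 0 < v -> v < 1 -> v < dist_fun P x -> v <= p.
  move=> v0 v1 vx; rewrite -lee_fin -pE -(height_law v0 v1).
  apply: le_measure; rewrite ?inE//.
  move=> w; rewrite /E /= /clip_dist /cell_dist; case: eqP => _ h.
    rewrite leNgt; apply/negP => /ltW /(dist_fun_homo P); rewrite P0; lra.
  have [h1 h2] := Vpos (sep_level c (clip w.1) (clip w.2)) _ _ (clip_ge0 w.1)
    (clip_lt1 w.1) (clip_ge0 w.2) (clip_lt1 w.2).
  by apply: quantile_le => //; exact: le_lt_trans h vx.
have up v : 0 < v -> v < 1 -> dist_fun P x < v -> p <= v.
  move=> v0 v1 vx; rewrite -lee_fin -pE -(height_law v0 v1).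
  apply: le_measure; rewrite ?inE//.
  move=> w; rewrite /E /= /clip_dist /cell_dist; case: eqP => _ h; first exact: ltW.
  have [h1 h2] := Vpos (sep_level c (clip w.1) (clip w.2)) _ _ (clip_ge0 w.1)
    (clip_lt1 w.1) (clip_ge0 w.2) (clip_lt1 w.2).
  rewrite leNgt; apply/negP => /(lt_trans vx) /(quantile_gt h1 h2).
  by rewrite ltNge h.
rewrite pE; congr EFin; apply: le_anti; apply/andP; split; rewrite leNgt; apply/negP => h.
- by have := up ((p + dist_fun P x) / 2); lra.
- by have := lo ((p + dist_fun P x) / 2); lra.
Qed.

End law.

(** * The metric space and its Borel sets *)

Section cell_space.
Context {R : realType}.
Variables (c psi : nat -> R -> R) (lo : nat -> R).
Hypotheses (cc : forall l, cell_fun (c l))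
  (c0 : forall y, 0 <= y -> y < 1 -> c 0%N y = 0)
  (cle : forall l y, c l y <= c l.+1 y)
  (cnd : forall l, nondegenerate_cells (c l))
  (cnr : forall l y, 0 <= y -> y < 1 ->
    exists z, [/\ y < z, z < 1, c l z = c l y & y < c l.+1 z])
  (csep : forall y z, 0 <= y -> y < z -> z < 1 -> exists l, c l y != c l z)
  (lo_gt0 : forall l, 0 < lo l)
  (lo_cvg : forall e, 0 < e -> exists l, lo l < e)
  (psi_mono : forall l, mono_on 0 1 (psi l))
  (psi_ge : forall l y, 0 <= y -> y < 1 -> lo l <= psi l y)
  (psi_le : forall l y, 0 <= y -> y < 1 -> psi l.+1 y <= lo l)
  (psi_osc : forall l m y z, (l < m)%N -> 0 <= y -> y <= z -> z < 1 ->
    c m y = c m z -> psi l z - psi l y <= lo m).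

Definition cell_space : completeMetricType R := dist_space
  (cell_complete_dist cc c0 cle cnr csep lo_gt0 lo_cvg psi_mono psi_ge psi_le psi_osc).

Definition clip_point (x : R) : cell_space :=
  exist (fun x : R => 0 <= x < 1) (clip x) (introT andP (conj (clip_ge0 x) (clip_lt1 x))).

Lemma mdist_clip_point (x y : R) :
  mdist (clip_point x) (clip_point y) = cell_dist c psi (clip x) (clip y).
Proof. by []. Qed.

Lemma cell_space_open (O : set cell_space) (x : R) : open O -> O (clip_point x) ->
  exists l, forall y, c l (clip y) = c l (clip x) -> O (clip_point y).
Proof.
move=> oO Ox; have : nbhs (clip_point x) O by exact: open_nbhs_nbhs.
move/nbhs_ballP => [e /= e0 eO].
have [l le] := lo_cvg e0; exists l.+1 => y cyx; apply: eO.
rewrite ballEmdist /= mdist_clip_point; apply: le_lt_trans le.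
apply: (cell_dist_le_lo cc c0 cle csep lo_gt0 psi_ge psi_le) => //;
  by rewrite ?clip_ge0 ?clip_lt1.
Qed.

Lemma clip_rat (x : R) l : 0 <= x -> x < 1 ->
  exists q : rat, c l (clip (ratr q)) = c l x.
Proof.
move=> x0 x1; have [z [xz z1 cz]] := cnd l x0 x1.
have [q] := rat_in_itvoo xz; rewrite in_itv/= => /andP[xq qz].
exists q; rewrite clip_id; [|lra|lra].
rewrite -cz; apply: (cc l).2; last exact: ltW.
by rewrite cz (le_trans ((cc l).1 x))// ltW.
Qed.

(** Every nonempty open set contains a cell, which has positive length and so meets the
    rationals. *)
Lemma cell_space_separable : separable cell_space.
Proof.
exists (range (fun q : rat => clip_point (ratr q))).
  exact: sub_countable (card_image_le _ _) (countableP _).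
move=> U [x Ux] oU.
have xE : x = clip_point (val x).
  by apply: val_inj; have /andP[h1 h2] := valP x; rewrite /= clip_id.
rewrite xE in Ux; have [l lU] := cell_space_open oU Ux.
have /andP[x0 x1] := valP x.
have [q cq] := clip_rat l x0 x1.
exists (clip_point (ratr q)); split; last by exists q.
by apply: lU; rewrite cq clip_id.
Qed.

(** An open set is the union of the cells it contains; each is named by a level and a rational
    point, so the union is countable. *)
Lemma measurable_clip_point : measurable_fun [set: measurableTypeR R]
  (clip_point : measurableTypeR R -> g_sigma_algebraType (@open cell_space)).
Proof.
have gE : @measurable _ (g_sigma_algebraType (@open cell_space)) = <<s @open cell_space >> by [].
apply: (measurability _ gE).
move=> _ [U oU <-]; rewrite setTI.
have -> : clip_point @^-1` U = \bigcup_l \bigcup_(q in [set: rat])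
    [set x : R | c l (clip x) = c l (clip (ratr q)) /\
      forall y, c l (clip y) = c l (clip (ratr q)) -> U (clip_point y)].
  apply/seteqP; split => x; last first.
    by move=> [l _ [q _ [cx]]]; apply.
  move=> /(cell_space_open oU)[l lO].
  have [q cq] := clip_rat l (clip_ge0 x) (clip_lt1 x).
  by exists l => //; exists q => //; split; rewrite cq.
apply: bigcupT_measurable => l; apply: bigcupT_measurable_rat => q.
have [h|h] := pselect (forall y, c l (clip y) = c l (clip (ratr q)) -> U (clip_point y)); last first.
  by rewrite (_ : [set _ | _] = set0)//; apply/seteqP; split => // x [].
rewrite (_ : [set _ | _] = (c l \o clip) @^-1` [set c l (clip (ratr q))]); last first.
  by apply/seteqP; split => x /=; [case|].
rewrite -[X in measurable X]setTI.
have mc : measurable_fun [set: measurableTypeR R] (c l).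
  by apply: nondecreasing_measurable => //; exact: cell_fun_homo.
by apply: (measurableT_comp mc measurable_clip) => //; exact: measurable_set1.
Qed.

End cell_space.

(** * Assembly of the space and the random elements *)

Theorem feasible_of_dist_fun (R : realType) (P : probability (measurableTypeR R) R) :
  dist_fun P 0 = 0 -> (forall e, 0 < e -> 0 < dist_fun P e) -> feasible P.
Proof.
move=> P0 Ppos; pose Q := quantile P.
have [c [[cc c0 cle cnd] cnr cprim V_itv osc]] := exists_levels
  (quantile_homo P0) (quantile_right P0) (quantile_gt0 P0).
pose V l := height (phi l.+1) (c l) (c l.+1).
have csep := cells_separate cc cprim.
pose lo l := Q (phi l.+1).
have lo_gt0 l : 0 < lo l by apply: quantile_gt0 => //; [exact: phi_gt0|exact: phiS_lt1].
have lo_cvg e : 0 < e -> exists l, lo l < e.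
  move=> e0; have e20 : 0 < e / 2 by lra.
  (* The mass near 0 makes the scales shrink: once [phi l] is below the mass up to [e / 2], the
     quantile there is at most [e / 2]. *)
  have [l le] := phi_cvg (Ppos _ e20); exists l.
  have : lo l <= e / 2.
    apply: quantile_le => //; first exact: phi_gt0.
    by apply: le_lt_trans le; exact: phi_homo.
  lra.
have psi_mono := psi_mono_on cc cle V_itv P0.
have psi_ge l y : 0 <= y -> y < 1 -> lo l <= (Q \o V l) y.
  move=> y0 y1; have /andP[h1 h2] := V_itv l _ y0 y1.
  apply: quantile_homo => //; first exact: phi_gt0.
  exact: lt_le_trans h2 (phi_le1 l).
have psi_le l y : 0 <= y -> y < 1 -> (Q \o V l.+1) y <= lo l.
  move=> y0 y1; have /andP[h1 h2] := V_itv l.+1 _ y0 y1.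
  apply: quantile_homo => //; last exact: phiS_lt1.
    exact: lt_le_trans (phi_gt0 _) h1.
  exact: ltW.
pose S := cell_space cc c0 cle cnr csep lo_gt0 lo_cvg psi_mono psi_ge psi_le osc.
pose pt : measurableTypeR R -> g_sigma_algebraType (@open S) :=
  @clip_point R c (fun l => Q \o V l) lo cc c0 cle cnr csep lo_gt0 lo_cvg psi_mono
    psi_ge psi_le osc.
have mpt : measurable_fun setT pt by exact: measurable_clip_point.
have mX : measurable_fun [set: measurableTypeR R * measurableTypeR R] (pt \o fst).
  exact: measurableT_comp mpt measurable_fst.
have mY : measurable_fun [set: measurableTypeR R * measurableTypeR R] (pt \o snd).
  exact: measurableT_comp mpt measurable_snd.
have mD := measurable_clip_dist cc c0 cle csep psi_mono.
pose X : {RV (@square_prob R) >-> g_sigma_algebraType (@open S)} :=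
  HB.pack (pt \o fst) (isMeasurableFun.Build _ _ _ _ (pt \o fst) mX).
pose Y : {RV (@square_prob R) >-> g_sigma_algebraType (@open S)} :=
  HB.pack (pt \o snd) (isMeasurableFun.Build _ _ _ _ (pt \o snd) mY).
pose D : {RV (@square_prob R) >-> measurableTypeR R} :=
  HB.pack (clip_dist c (fun l => Q \o V l)) (isMeasurableFun.Build _ _ _ _ _ mD).
(* The product formula; a full factor gives the marginals, and these turn it into independence. *)
have PX A B : measurable A -> measurable B ->
    square_prob (X @^-1` A `&` Y @^-1` B) = (unit_prob (pt @^-1` A) * unit_prob (pt @^-1` B))%E.
  move=> mA mB; rewrite -product_measure1E//.
    by rewrite -[X in measurable X]setTI; exact: mpt.
  by rewrite -[X in measurable X]setTI; exact: mpt.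
have XA A : measurable A -> square_prob (X @^-1` A) = unit_prob (pt @^-1` A).
  move=> mA; have := PX A setT mA measurableT.
  by rewrite !preimage_setT setIT probability_setT mule1.
have YA A : measurable A -> square_prob (Y @^-1` A) = unit_prob (pt @^-1` A).
  move=> mA; have := PX setT A measurableT mA.
  by rewrite !preimage_setT setTI probability_setT mul1e.
exists S, (distribution square_prob X), _, (measurableTypeR R * measurableTypeR R)%type.
exists square_prob, X, Y, D; split.
- exact: cell_space_separable.
- by move=> A mA; split; [|exact: etrans (YA A mA) (esym (XA A mA))].
- by move=> A B mA mB; rewrite PX// XA// YA.
- by [].
- apply: probability_eq_dist_fun => x; apply: EFin_inj.
  rewrite [LHS]dist_funE -(dist_law cc c0 cle cprim V_itv P0).
  by congr (square_prob _); apply/seteqP; split => w; rewrite /= in_itv.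
Qed.

Theorem corollary1p2 (R : realType)
    (Theta : probability (measurableTypeR R) R) (f : R -> R)
    (Theta_nneg : on_nonneg_reals Theta)
    (Theta_f : has_density Theta f)
    (Theta_0 : zero_in_support Theta) :
  feasible Theta.
Proof.
have sub_itv x : `]-oo, x]%classic `<=` ~` `[0%R, +oo[%classic `|` (`[0%R, x]%classic : set R).
  move=> y; rewrite /= !in_itv/= andbT => yx.
  by have [y0|y0] := leP 0 y; [right|left].
apply: feasible_of_dist_fun => [|e e0].
- apply: EFin_inj; rewrite dist_funE; apply/eqP; rewrite eq_le measure_ge0 andbT.
  have [_ _ Theta_int] := Theta_f.
  (* The density rules out an atom at 0, which would make distinct points coincide. *)
  have T0 : Theta [set 0%R] = 0%E.
    rewrite Theta_int ?integral_set1//.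
    by move=> x /= ->; rewrite in_itv/= lexx.
  have TN : Theta (~` `[0%R, +oo[%classic) = 0%E.
    by rewrite probability_setC// Theta_nneg subee.
  apply: (@le_trans _ _ (Theta (~` `[0%R, +oo[%classic `|` [set 0%R]))).
    apply: le_measure; rewrite ?inE//.
      by apply: measurableU => //; exact: measurableC.
    by have := sub_itv 0; rewrite set_itv1.
  apply: le_trans (measureU2 _ _ _) _ => //; first exact: measurableC.
  by rewrite [X in (X + _)%E]TN [X in (_ + X)%E]T0 adde0.
- rewrite -lte_fin dist_funE; apply: lt_le_trans (Theta_0 e e0) _.
  apply: le_measure; rewrite ?inE//.
  by apply: subset_itvr; rewrite bnd_simp.
Qed.
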